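(* Let $K$ be a field, let $n\ge 3$, let $M$ be the Chinese monoid of rank $n$, and let $D$ be the tree of diagrams for $n$, with associated congruences $\rho(d)$ on $M$ for $d\in D$. There exists a bijection between the set of leaves of $D$ and the set of minimal prime ideals of $K[M]$. Namely, for every leaf $d$ of $D$ the ideal $\mathcal{I}_{\rho(d)}$ is a minimal prime ideal of $K[M]$, and $d\mapsto \mathcal{I}_{\rho(d)}$ is a bijection from the set of leaves of $D$ onto the set of minimal prime ideals of $K[M]$.
   Context: The Chinese monoid of rank $n$ is the monoid $M=\langle a_1,\dots,a_n\rangle$ defined by the relations $a_ja_ia_k=a_ja_ka_i=a_ka_ja_i$ for $i\le k\le j$; $K[M]$ is its monoid algebra. For a congruence $\eta$ on $M$, $\mathcal{I}_\eta$ is the ideal of $K[M]$ spanned over $K$ by $\{s-t: (s,t)\in\eta\}$. **The tree $D$.** A diagram is a collection of dots (a dot $a_s$ uses the single index $s$) and arcs (an arc $a_ya_x$, $x<y$, uses the two indices $x,y$) on $\{1,\dots,n\}$, each index being used at most once. The vertices of the finite tree $D$ are the following diagrams, built level by level. The root (level 0) is the empty diagram. The children of the root (level 1) are the $n-2$ single dots $a_s$, $s=2,\dots,n-1$, and the $n-1$ single arcs $a_sa_{s-1}$, $s=2,\dots,n$. In each non-root vertex the used indices form an interval $\{u,u+1,\dots,v\}$. A non-root vertex is a leaf (it has no children) if it contains an arc using index $1$ or index $n$. If a non-root vertex $d$ with used interval $\{u,\dots,v\}$ is not a leaf (then $1<u\le v<n$), its children are: (i) the diagram obtained by adding the arc $a_{v+1}a_{u-1}$;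 (ii) if the last step in the construction of $d$ was adding an arc: the diagram obtained by adding the dot $a_{v+1}$ (provided $v+1<n$) and the diagram obtained by adding the dot $a_{u-1}$ (provided $u-1>1$); (iii) if $d$ is in level $\ge 2$ and the last step was adding a dot: if that dot was $a_v$, the diagram obtained by adding the dot $a_{v+1}$ (provided $v+1<n$); if that dot was $a_u$, the diagram obtained by adding the dot $a_{u-1}$ (provided $u-1>1$). (If $d$ is a single dot in level 1, its only child is the one in (i).) **The congruences $\rho(d)$.** Let $B=\langle p,q: qp=1\rangle$ be the bicyclic monoid, let $\mathbb{N}$ (nonnegative integers under addition) be written multiplicatively as $\langle g\rangle$, and $\mathbb{Z}$ as $\langle g,g^{-1}\rangle$. For an interval $\{u,\dots,v\}$ let $C_{u,v}$ be the monoid generated by the $a_i$ with $i<u$ or $i>v$, subject to the Chinese relations among these generators and the additional relations that $a_1,\dots,a_{u-1}$ commute with each other and $a_{v+1},\dots,a_n$ commute with each other (it is trivial if there are no generators). Let $d\in D$ be in level $r$, with branch $d_0$ (root), $d_1,\dots,d_r=d$ leading from the root to $d$. Put $C_0=M$, $S_0=\{1\}$, and for $t\ge1$ let $C_t=C_{u,v}$, where $\{u,\dots,v\}$ is the set of used indices of $d_t$. For $0\le t<r$: - if $d_{t+1}$ arises from $d_t$ by adding a dot $a_s$, put $S_{t+1}=\mathbb{N}\times S_t$ and let $\psi_t: C_t\to C_{t+1}\times \mathbb{N}$ be the homomorphism with $a_s\mapsto(1,g)$ and $a_l\mapsto(a_l,1)$ for $l\ne s$; - if $d_{t+1}$ arises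 from $d_t$ by adding an arc $a_ya_x$ ($x<y$), put $S_{t+1}=B\times\mathbb{Z}\times S_t$ and let $\psi_t:C_t\to C_{t+1}\times B\times\mathbb{Z}$ be the homomorphism with $a_x\mapsto(1,p,g)$, $a_y\mapsto(1,q,1)$, $a_l\mapsto(a_l,p,1)$ for $l<x$, $a_l\mapsto(a_l,q,1)$ for $l>y$. Let $\kappa_t=\psi_t\times \mathrm{id}: C_t\times S_t\to C_{t+1}\times S_{t+1}$. Then $\rho(\text{root})$ is the trivial congruence on $M$ and, for $r\ge1$, $\rho(d)$ is the kernel congruence of $\kappa_{r-1}\circ\dots\circ\kappa_0: M\to C_r\times S_r$. *)

(* Defs.v *)
From HB Require Import structures.
From mathcomp Require Import all_boot all_algebra zify.
From mathcomp Require Import boolp classical_sets functions.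
From mathcomp.multinomials Require Import monalg.

Set Implicit Arguments.
Unset Strict Implicit.
Unset Printing Implicit Defensive.

Import GRing.Theory.

(** * Monoids given by generators and relations *)

Section Presentation.
Variables (T : choiceType) (R : seq T -> seq T -> Prop).

Inductive word_congr : seq T -> seq T -> Prop :=
| WRel l r u v : R u v -> word_congr (l ++ u ++ r) (l ++ v ++ r)
| WRefl w : word_congr w w
| WSym w1 w2 : word_congr w1 w2 -> word_congr w2 w1
| WTrans w1 w2 w3 : word_congr w1 w2 -> word_congr w2 w3 -> word_congr w1 w3.

Definition word_congrb w1 w2 : bool := `[< word_congr w1 w2 >].

Lemma word_congrb_refl : reflexive word_congrb.
Proof. by move=> w; apply/asboolP/WRefl. Qed.

Lemma word_congrb_sym : symmetric word_congrb.
Proof. by move=> u v; apply/asboolP/asboolP => /WSym. Qed.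

Lemma word_congrb_trans : transitive word_congrb.
Proof.
by move=> v u w /asboolP h1 /asboolP h2; apply/asboolP; apply: WTrans h1 h2.
Qed.

Canonical word_congrb_equiv :=
  EquivRel word_congrb word_congrb_refl word_congrb_sym word_congrb_trans.

Definition presented := {eq_quot word_congrb}%qT.
HB.instance Definition _ := Choice.on presented.
HB.instance Definition _ := EqQuotient.on presented.

Definition cls (w : seq T) : presented := (\pi_presented w)%qT.
Definition pgen (x : T) : presented := cls [:: x].

Lemma clsP w1 w2 : cls w1 = cls w2 <-> word_congr w1 w2.
Proof.
split=> [/eqP|h]; first by rewrite /cls eqmodE => /asboolP.
by apply/eqP; rewrite /cls eqmodE; apply/asboolP.
Qed.

Lemma cls_repr (x : presented) : cls (repr x) = x.
Proof. exact: reprK. Qed.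

Lemma word_congr_ctx l r u v :
  word_congr u v -> word_congr (l ++ u ++ r) (l ++ v ++ r).
Proof.
elim=> {u v} [l' r' u v Ruv|w|u v _|u v w _ h1 _ h2].
- have := @WRel (l ++ l') (r' ++ r) u v Ruv.
  by rewrite -!catA.
- exact: WRefl.
- exact: WSym.
- exact: WTrans h1 h2.
Qed.

Lemma word_congr_cat u u' v v' :
  word_congr u u' -> word_congr v v' -> word_congr (u ++ v) (u' ++ v').
Proof.
move=> hu hv; apply: (@WTrans _ (u' ++ v)).
  exact: (@word_congr_ctx [::] v _ _ hu).
by have := @word_congr_ctx u' [::] _ _ hv; rewrite !cats0.
Qed.

Definition presented_one : presented := cls [::].
Definition presented_mul (x y : presented) : presented := cls (repr x ++ repr y).

Lemma cls_cat u v : cls (u ++ v) = presented_mul (cls u) (cls v).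
Proof.
by apply/clsP/word_congr_cat; apply/clsP; rewrite cls_repr.
Qed.

Lemma presented_mulA : associative presented_mul.
Proof.
by move=> x y z; rewrite -(cls_repr x) -(cls_repr y) -(cls_repr z)
  -!cls_cat catA.
Qed.

Lemma presented_mul1 : left_id presented_one presented_mul.
Proof. by move=> x; rewrite -(cls_repr x) -cls_cat. Qed.

Lemma presented_mulr1 : right_id presented_one presented_mul.
Proof. by move=> x; rewrite -(cls_repr x) -cls_cat cats0. Qed.

HB.instance Definition _ := isMonoid.Build presented
  presented_mulA presented_mul1 presented_mulr1.

(* [extend f] is the homomorphism sending each generator [x] to [f x]; it is
   total, and is a homomorphism as soon as [f] satisfies the relations
   (lemma [extend_morphism]). *)
Definition extend (N : monoidType) (f : T -> N) (m : presented) : N :=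
  (\prod_(x <- repr m) f x)%g.

Lemma extend_cls (N : monoidType) (f : T -> N) :
  (forall u v, R u v ->
    (\prod_(x <- u) f x = \prod_(x <- v) f x)%g) ->
  forall w, extend f (cls w) = (\prod_(x <- w) f x)%g.
Proof.
move=> Hf w; rewrite /extend.
have: word_congr (repr (cls w)) w by apply/clsP; rewrite cls_repr.
move: (repr _) => u; elim=> {u w} [l r u v /Hf e|//|u v _ -> //|u v w _ -> _ -> //].
by rewrite !big_cat /= e.
Qed.

Lemma extend_morphism (N : monoidType) (f : T -> N) :
  (forall u v, R u v ->
    (\prod_(x <- u) f x = \prod_(x <- v) f x)%g) ->
  [/\ (forall x, extend f (pgen x) = f x),
      extend f 1%g = 1%g
    & {morph extend f : x y / (x * y)%g >-> (x * y)%g}].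
Proof.
move=> Hf; have E := extend_cls Hf; split=> [x||x y].
- by rewrite E big_seq1.
- by rewrite (E [::]) big_nil.
- rewrite -(cls_repr x) -(cls_repr y) -[(_ * _)%g]cls_cat !E big_cat //.
Qed.

Lemma pgen_mul2 x y : (pgen x * pgen y)%g = cls [:: x; y].
Proof. by rewrite -[(_ * _)%g]cls_cat. Qed.

Lemma pgen_mul3 x y z : (pgen x * (pgen y * pgen z))%g = cls [:: x; y; z].
Proof. by rewrite pgen_mul2 -[(_ * _)%g]cls_cat. Qed.

Lemma cls_rel u v : R u v -> cls u = cls v.
Proof.
move=> Ruv; apply/clsP; rewrite -[u]cats0 -[v]cats0.
exact: (@WRel [::] [::] u v Ruv).
Qed.

End Presentation.

Lemma unit_mulA : associative (fun _ _ : unit => tt).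
Proof. by []. Qed.

Lemma unit_mul1 : left_id tt (fun _ _ : unit => tt).
Proof. by case. Qed.

Lemma unit_mulr1 : right_id tt (fun _ _ : unit => tt).
Proof. by case. Qed.

HB.instance Definition _ := isMonoid.Build unit unit_mulA unit_mul1 unit_mulr1.

(** * The Chinese monoid *)

(* Chinese relations, together with the commutation of the pairs of generators
   selected by [com]; [idx] gives the index of a generator. *)
Inductive chinese_rel (G : Type) (idx : G -> nat) (com : rel nat) :
  seq G -> seq G -> Prop :=
| Chinese1 i k j : idx i <= idx k <= idx j ->
    chinese_rel idx com [:: j; i; k] [:: j; k; i]
| Chinese2 i k j : idx i <= idx k <= idx j ->
    chinese_rel idx com [:: j; k; i] [:: k; j; i]
| ChineseCom i j : com (idx i) (idx j) ->
    chinese_rel idx com [:: i; j] [:: j; i].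

(* Indices are shifted by one throughout: the generator a_s is [s.-1 : 'I_n]. *)
Definition chinese_monoid (n : nat) : Type :=
  presented (@chinese_rel 'I_n val (fun _ _ => false)).

HB.instance Definition _ n := Choice.on (chinese_monoid n).
HB.instance Definition _ n := Monoid.on (chinese_monoid n).

Lemma chinese_congr_size n (u v : seq 'I_n) :
  word_congr (chinese_rel val (fun _ _ => false)) u v -> size u = size v.
Proof.
elim=> {u v} [l r u v Ruv|w|u v _ ->|u v w _ -> _ ->] //.
by rewrite !size_cat; case: Ruv.
Qed.

Lemma chinese_unitm n (x y : chinese_monoid n) :
  (x * y = 1)%g -> x = 1%g /\ y = 1%g.
Proof.
rewrite -(cls_repr x) -(cls_repr y) -[(_ * _)%g]cls_cat.
move=> /clsP/chinese_congr_size/eqP.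
by rewrite size_cat addn_eq0 !size_eq0 => /andP[/eqP-> /eqP->].
Qed.

HB.instance Definition _ n := Choice_isMonomialDef.Build (chinese_monoid n)
  (@mulgA (chinese_monoid n)) (@mul1g (chinese_monoid n)) (@mulg1 (chinese_monoid n))
  (@chinese_unitm n).

(** * Diagrams and the tree D *)

(* [inl s] is the dot a_s and [inr (x, y)], with x < y, is the arc a_y a_x. *)
Definition item (n : nat) : Type := ('I_n + 'I_n * 'I_n)%type.
Notation Dot s := (inl s) (only parsing).
Notation Arc x y := (inr (x, y)) (only parsing).

Definition diagram (n : nat) : Type := {set item n}.

Section Tree.
Variable n : nat.
Implicit Types (b : seq (item n)) (c : item n) (d : diagram n).

(* A branch from the root to a vertex is recorded as the list of items added
   at each step, the last one first. *)
Definition diag b : diagram n := [set c in b].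

(* The used interval {u, ..., v} is [lo b, hi b], for b nonempty. *)
Definition item_lo c : nat := match c with Dot s => s | Arc x _ => x end.
Definition item_hi c : nat := match c with Dot s => s | Arc _ y => y end.
Definition lo b : nat := foldr minn n (map item_lo b).
Definition hi b : nat := foldr maxn 0 (map item_hi b).

Definition has_end_arc d : bool :=
  [exists x : 'I_n, exists y : 'I_n,
     (Arc x y \in d) && ((x == 0 :> nat) || (y.+1 == n))].

Definition child b c : bool :=
  match c with
  | Dot s =>
      match b with
      | [::] => (0 < s) && (s.+1 < n)
      | [:: Dot _] => false
      | Dot t :: _ =>
          ~~ has_end_arc (diag b) &&
          ([&& t == hi b :> nat, s == (hi b).+1 :> nat & s.+1 < n] ||
           [&& t == lo b :> nat, s.+1 == lo b & 0 < s])
      | Arc _ _ :: _ =>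
          ~~ has_end_arc (diag b) &&
          ((s == (hi b).+1 :> nat) && (s.+1 < n) || (s.+1 == lo b) && (0 < s))
      end
  | Arc x y =>
      if b is [::] then y == x.+1 :> nat
      else [&& ~~ has_end_arc (diag b), x.+1 == lo b & y == (hi b).+1 :> nat]
  end.

Fixpoint is_branch b : bool :=
  if b is c :: b' then is_branch b' && child b' c else true.

Definition vertex d : Prop := exists2 b, is_branch b & diag b = d.

Definition leaf d : Prop := vertex d /\ has_end_arc d.

Lemma lo_cons c b : lo (c :: b) <= lo b. Proof. exact: geq_minr. Qed.

Lemma hi_cons c b : hi b <= hi (c :: b). Proof. exact: leq_maxr. Qed.

Lemma lo_le_hi c b : is_branch (c :: b) -> lo (c :: b) <= hi (c :: b).
Proof.
elim: b c => [|c' b IH] c br; apply: leq_trans (geq_minl _ _) _;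
  apply: leq_trans (leq_maxl _ _); case: c br => [//|[x y]].
  by rewrite /= => /eqP->.
case/andP=> br /and3P[_ /eqP ex /eqP ey] /=; rewrite ey; apply: ltnW.
by apply: leq_trans (leqW (IH c' br)); rewrite -ex.
Qed.

Definition uses c (i : nat) : bool :=
  match c with inl s => s == i :> nat | inr (x, y) => (x == i :> nat) || (y == i :> nat) end.

Lemma lo_consE c b : lo (c :: b) = minn (item_lo c) (lo b). Proof. by []. Qed.

Lemma hi_consE c b : hi (c :: b) = maxn (item_hi c) (hi b). Proof. by []. Qed.

Lemma branchW c b : is_branch (c :: b) -> is_branch b.
Proof. by case/andP. Qed.

Lemma item_le c b : is_branch (c :: b) -> item_lo c <= item_hi c.
Proof.
case: c => [//|[x y]]; case: b => [|c b].
  by rewrite /= => /eqP->.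
case/andP=> /lo_le_hi br /and3P[_ /eqP ex /eqP ey] /=; rewrite ey.
by apply: ltnW; rewrite ltnS (leq_trans _ br) // -ex.
Qed.

Lemma uses_item c b i : is_branch (c :: b) -> uses c i ->
  item_lo c <= i <= item_hi c.
Proof.
move/item_le; case: c => [s|[x y]] /=; first by move=> _ /eqP->; rewrite leqnn.
by move=> xy /orP[]/eqP<-; rewrite leqnn ?andbT.
Qed.

Lemma uses_bound b c i : is_branch b -> c \in b -> uses c i -> lo b <= i <= hi b.
Proof.
elim: b => [//|c0 b IH] br; rewrite inE => /orP[/eqP->|cb] u.
  have /andP[h1 h2] := uses_item br u.
  by rewrite (leq_trans (geq_minl _ _) h1) (leq_trans h2 (leq_maxl _ _)).
have {}br := branchW br; have /andP[h1 h2] := IH br cb u.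
by rewrite (leq_trans (lo_cons _ _) h1) (leq_trans h2 (hi_cons _ _)).
Qed.

Lemma child_fresh c c' b i : is_branch [:: c, c' & b] -> uses c i ->
  (i < lo (c' :: b)) || (hi (c' :: b) < i).
Proof.
case/andP=> _; case: c => [s|[x y]] /=; last first.
  by case/and3P=> _ /eqP<- /eqP ey /orP[]/eqP<-; rewrite ?ltnSn // ey ltnSn orbT.
case: c' => [t|[x y]]; first case: b => [//|c' b].
  case/andP=> _ + /eqP<-; case/orP=> /and3P[_].
    by move=> /eqP-> _; rewrite ltnSn orbT.
  by move=> /eqP<- _; rewrite ltnSn.
case/andP=> _ + /eqP<-; case/orP=> /andP[].
  by move=> /eqP-> _; rewrite ltnSn orbT.
by move=> /eqP<- _; rewrite ltnSn.
Qed.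

Lemma fresh c b c' i : is_branch (c :: b) -> c' \in b -> uses c' i -> uses c i = false.
Proof.
case: b => [//|c0 b] br cb u; apply/negP => /(child_fresh br).
have {}br := branchW br; have /andP[h1 h2] := uses_bound br cb u.
by rewrite !ltnNge h1 h2.
Qed.

Lemma uses_inj b c c' i : is_branch b -> c \in b -> c' \in b -> uses c i -> uses c' i -> c = c'.
Proof.
elim: b => [//|c0 b IH] br; rewrite !inE => /orP[/eqP->|h] /orP[/eqP->|h'] u u' //.
- by rewrite (fresh br h' u') in u.
- by rewrite (fresh br h u) in u'.
- by apply: IH => //; apply: branchW br.
Qed.

Lemma uses_lo c : uses c (item_lo c). Proof. by case: c => [s|[x y]] /=; rewrite eqxx. Qed.
Lemma uses_hi c : uses c (item_hi c). Proof. by case: c => [s|[x y]] /=; rewrite eqxx ?orbT. Qed.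

Lemma uses_lo_ex b : is_branch b -> b != [::] -> exists2 c, c \in b & uses c (lo b).
Proof.
elim: b => [//|c b IH] br _; have [h|h] := leqP (item_lo c) (lo b).
  exists c; rewrite ?mem_head // /lo /= -/(lo b) (minn_idPl h); exact: uses_lo.
case: b => [|c' b] in IH br h *.
  exists c; rewrite ?mem_head // /lo /=; case: c {br h} => [s|[x y]] /=.
    by rewrite (minn_idPl (ltnW (ltn_ord s))).
  by rewrite (minn_idPl (ltnW (ltn_ord x))) eqxx.
have {}br := branchW br; have [//|c0 c0b u] := IH br.
exists c0; first by rewrite inE c0b orbT.
by rewrite lo_consE (minn_idPr (ltnW h)).
Qed.

Lemma uses_hi_ex b : is_branch b -> b != [::] -> exists2 c, c \in b & uses c (hi b).
Proof.
elim: b => [//|c b IH] br _; have [h|h] := leqP (hi b) (item_hi c).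
  exists c; rewrite ?mem_head // /hi /= -/(hi b) (maxn_idPl h); exact: uses_hi.
case: b => [//|c' b] in IH br h *.
have {}br := branchW br; have [//|c0 c0b u] := IH br.
exists c0; first by rewrite inE c0b orbT.
by rewrite hi_consE (maxn_idPr (ltnW h)).
Qed.

Lemma diag_lohi b1 b2 : is_branch b1 -> is_branch b2 -> b1 != [::] ->
  b1 =i b2 -> lo b1 = lo b2 /\ hi b1 = hi b2.
Proof.
move=> br1 br2 n1 e.
have n2 : b2 != [::] by apply: contra_neq n1 => b0; move: e; rewrite b0; case: b1 {br1} => // c b /(_ c); rewrite mem_head.
have bnd b b' c i : is_branch b' -> b =i b' -> c \in b -> uses c i -> lo b' <= i <= hi b'.
  by move=> br eb cb; apply: uses_bound br _; rewrite -eb.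
have [c1 m1 /(bnd _ _ _ _ br2 e m1) /andP[l1 _]] := uses_lo_ex br1 n1.
have [c2 m2 /(bnd _ _ _ _ br2 e m2) /andP[_ h1]] := uses_hi_ex br1 n1.
have e' : b2 =i b1 by move=> x; rewrite e.
have [c3 m3 /(bnd _ _ _ _ br1 e' m3) /andP[l2 _]] := uses_lo_ex br2 n2.
have [c4 m4 /(bnd _ _ _ _ br1 e' m4) /andP[_ h2]] := uses_hi_ex br2 n2.
by split; apply/eqP; rewrite eqn_leq ?l1 ?l2 ?h1 ?h2.
Qed.

Lemma child_dot s c' b : is_branch [:: inl s, c' & b] ->
  s.+1 = lo (c' :: b) \/ s = (hi (c' :: b)).+1 :> nat.
Proof.
case/andP=> _ /=; case: c' => [t|[x y]]; first case: b => [//|c' b].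
  case/andP=> _ /orP[]/and3P[_ /eqP h _]; tauto.
by case/andP=> _ /orP[]/andP[/eqP h _]; tauto.
Qed.

Lemma head_arc x y b : is_branch (inr (x, y) :: b) ->
  x = lo (inr (x, y) :: b) :> nat /\ y = hi (inr (x, y) :: b) :> nat.
Proof.
case: b => [|c b] br.
  by rewrite /lo /hi /= maxn0 (minn_idPl (ltnW (ltn_ord x))).
case/andP: br => /lo_le_hi br /and3P[_ /eqP ex /eqP ey].
rewrite (lo_consE (inr _)) (hi_consE (inr _)) /=; lia.
Qed.

Lemma head_dot s b : is_branch (inl s :: b) ->
  s = lo (inl s :: b) :> nat \/ s = hi (inl s :: b) :> nat.
Proof.
case: b => [|c b] br; first by right; rewrite /hi /= maxn0.
have := child_dot br; case/andP: br => /lo_le_hi br _.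
rewrite (lo_consE (inl s)) (hi_consE (inl s)) /=; lia.
Qed.

Lemma dot_lo s t b : is_branch (inl s :: b) -> inl t \in inl s :: b ->
  s = lo (inl s :: b) :> nat -> t = hi (inl s :: b) :> nat -> s = t.
Proof.
elim: b s t => [|c b IH] s t br; first by rewrite inE => /eqP[->].
rewrite inE => /orP[/eqP[->//]|tb] es et.
have := child_dot br; have br' := branchW br; case/andP: (br) => _ cd; have l := lo_le_hi br'.
move: es et; rewrite (lo_consE (inl s)) (hi_consE (inl s)) [item_lo _]/= [item_hi _]/= => es et [e|e]; last lia.
have {}et : t = hi (c :: b) :> nat by lia.
case: c => [u|[x y]] in br br' cd l tb es et e *; last first.
  have [_ ey] := head_arc br'.
  have : inl t = inr (x, y) :> item n.
    by apply: (@uses_inj _ _ _ t br' tb (mem_head _ _)); rewrite /= ?eqxx // ey et eqxx orbT.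
  by [].
case: b => [//|c b] in IH br br' cd l tb es et e *.
move: cd => /=; case/andP=> _ /orP[]/and3P[/eqP h1 /eqP h2 _]; first lia.
have ut := IH _ _ br' tb h1 et; subst u.
have br2 := branchW br'; have l2 := lo_le_hi br2.
have := child_dot br'; move: h1 et.
rewrite (lo_consE (inl t)) (hi_consE (inl t)) /=; lia.
Qed.

Lemma dot_hi s t b : is_branch (inl s :: b) -> inl t \in inl s :: b ->
  s = hi (inl s :: b) :> nat -> t = lo (inl s :: b) :> nat -> s = t.
Proof.
elim: b s t => [|c b IH] s t br; first by rewrite inE => /eqP[->].
rewrite inE => /orP[/eqP[->//]|tb] es et.
have := child_dot br; have br' := branchW br; case/andP: (br) => _ cd; have l := lo_le_hi br'.
move: es et; rewrite (lo_consE (inl s)) (hi_consE (inl s)) [item_lo _]/= [item_hi _]/= => es et [e|e]; first lia.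
have {}et : t = lo (c :: b) :> nat by lia.
case: c => [u|[x y]] in br br' cd l tb es et e *; last first.
  have [ex _] := head_arc br'.
  have : inl t = inr (x, y) :> item n.
    by apply: (@uses_inj _ _ _ t br' tb (mem_head _ _)); rewrite /= ?eqxx // ex et eqxx.
  by [].
case: b => [//|c b] in IH br br' cd l tb es et e *.
move: cd => /=; case/andP=> _ /orP[]/and3P[/eqP h1 /eqP h2 _]; last lia.
have ut := IH _ _ br' tb h1 et; subst u.
have br2 := branchW br'; have l2 := lo_le_hi br2.
have := child_dot br'; move: h1 et.
rewrite (lo_consE (inl t)) (hi_consE (inl t)) /=; lia.
Qed.

Lemma head_uniq c1 b1 c2 b2 : is_branch (c1 :: b1) -> is_branch (c2 :: b2) ->
  c1 :: b1 =i c2 :: b2 -> c1 = c2.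
Proof.
move=> br1 br2 e; have [el eh] := diag_lohi br1 br2 isT e.
have m2 : c2 \in c1 :: b1 by rewrite e mem_head.
have m1 : c1 \in c2 :: b2 by rewrite -e mem_head.
case: c1 => [s|[x y]] in br1 e el eh m1 m2 *; case: c2 => [t|[x' y']] in br2 e el eh m1 m2 *.
- have := head_dot br1; have := head_dot br2; rewrite -el -eh => -[h2|h2] -[h1|h1].
  + by congr inl; apply: val_inj; rewrite /= h1 h2.
  + by congr inl; apply: dot_hi br1 m2 h1 h2.
  + by congr inl; apply: dot_lo br1 m2 h1 h2.
  + by congr inl; apply: val_inj; rewrite /= h1 h2.
- have [hx hy] := head_arc br2; apply: (uses_inj (i := s) br2 m1 (mem_head _ _)) => /=; first by rewrite eqxx.
  by have := head_dot br1; rewrite el eh -hx -hy => -[]->; rewrite eqxx ?orbT.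
- have [hx hy] := head_arc br1; apply: (uses_inj (i := t) br1 (mem_head _ _) m2) => /=; last by rewrite eqxx.
  by have := head_dot br2; rewrite -el -eh -hx -hy => -[]->; rewrite eqxx ?orbT.
- have [hx hy] := head_arc br1; have [hx' hy'] := head_arc br2.
  by congr (inr (_, _)); apply: val_inj; rewrite /= ?hx ?hx' ?hy ?hy'.
Qed.

Lemma branch_unique b1 b2 : is_branch b1 -> is_branch b2 -> diag b1 = diag b2 -> b1 = b2.
Proof.
move=> br1 br2 /setP e0; have {e0} e : b1 =i b2 by move=> c; have := e0 c; rewrite !inE.
elim: b1 b2 br1 br2 e => [|c1 b1 IH] [|c2 b2] br1 br2 e //.
- by have := e c2; rewrite mem_head.
- by have := e c1; rewrite mem_head.
have ec := head_uniq br1 br2 e; subst c2.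
have nin b : is_branch (c1 :: b) -> c1 \notin b.
  by move=> br; apply/negP=> h; have := fresh br h (uses_lo c1); rewrite uses_lo.
congr (_ :: _); apply: IH; [exact: branchW br1|exact: branchW br2|move=> c].
have := e c; rewrite !inE; case: eqP => [->|//].
by rewrite (negbTE (nin _ br1)) (negbTE (nin _ br2)).
Qed.
End Tree.

(** * The congruences rho(d) *)

Inductive bicyclic_rel : seq bool -> seq bool -> Prop :=
| BicyclicQP : bicyclic_rel [:: true; false] [::].

(* The bicyclic monoid <p, q : qp = 1>. *)
Definition bicyclic : monoidType := presented bicyclic_rel.
Definition bp : bicyclic := pgen bicyclic_rel false.
Definition bq : bicyclic := pgen bicyclic_rel true.

(* Multiplicative copies of (nat, +) and (int, +), with generator g = 1. *)
Definition natM : monoidType := Algebra.to_multiplicative nat.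
Definition intM : monoidType := Algebra.to_multiplicative int.
Definition natM_g : natM := 1%N.
Definition intM_g : intM := 1%:Z%R.

Section Rho.
Variable n : nat.
Implicit Types (b : seq (item n)) (c : item n) (d : diagram n).

(* Generators of C_t, and their commutation relations besides the Chinese ones,
   for the last vertex d_t of the branch b; C_0 is the Chinese monoid itself. *)
Definition Cgen b : choiceType :=
  if b is [::] then 'I_n
  else {i : 'I_n | (i < lo b) || (hi b < i)}.

Definition Cidx b : Cgen b -> 'I_n :=
  match b with [::] => id | _ :: _ => val end.

Definition Ccom b : rel nat := fun i j =>
  if b is [::] then false
  else (i < lo b) && (j < lo b) || (hi b < i) && (hi b < j).

Definition Cmon b : monoidType := presented (chinese_rel (@Cidx b) (Ccom b)).

(* a_l as an element of C_{t+1}, and 1 when l is a used index. *)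
Definition Celt b c (l : 'I_n) : Cmon (c :: b) :=
  if insub l is Some i then pgen _ (i : Cgen (c :: b)) else 1%g.

Definition step_monoid c : monoidType :=
  match c with Dot _ => natM | Arc _ _ => (bicyclic * intM)%type end.

Fixpoint Smon b : monoidType :=
  if b is c :: b' then (step_monoid c * Smon b')%type else unit.

(* When an arc a_y a_x is added, each index l of a generator of C_t satisfies
   l <= x or y <= l. *)
Definition step_elt c (l : 'I_n) : step_monoid c :=
  match c return step_monoid c with
  | Dot s => if l == s then natM_g else 1%g
  | Arc x y => (if l <= x then bp else bq, if l == x then intM_g else 1%g)
  end.

Definition psi b c : Cmon b -> (Cmon (c :: b) * step_monoid c)%type :=
  extend (fun i : Cgen b => (Celt b c (Cidx i), step_elt c (Cidx i))).

Fixpoint kappa b : chinese_monoid n -> (Cmon b * Smon b)%type :=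
  match b return chinese_monoid n -> (Cmon b * Smon b)%type with
  | [::] => fun m => (m, 1%g)
  | c :: b' => fun m =>
      let: (m', s) := kappa b' m in
      let: (m'', w) := psi c m' in (m'', (w, s))
  end.

Lemma Celt_used b c (l : 'I_n) : lo (c :: b) <= l <= hi (c :: b) ->
  Celt b c l = 1%g.
Proof.
move=> /andP[h1 h2]; rewrite /Celt insubF //.
by apply/negbTE; rewrite negb_or -!leqNgt h1 h2.
Qed.

Lemma Celt_com b c (i j : 'I_n) :
  (i <= hi (c :: b)) && (j <= hi (c :: b))
  || (lo (c :: b) <= i) && (lo (c :: b) <= j) ->
  (Celt b c i * Celt b c j = Celt b c j * Celt b c i)%g.
Proof.
move=> hij; case: (boolP (lo (c :: b) <= i <= hi (c :: b))) => [hi_|hi_].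
  by rewrite (Celt_used hi_) mul1g mulg1.
case: (boolP (lo (c :: b) <= j <= hi (c :: b))) => [hj|hj].
  by rewrite (Celt_used hj) mul1g mulg1.
rewrite /Celt; case: insubP => [i' _ ei|]; last by rewrite mul1g mulg1.
case: insubP => [j' _ ej|]; last by rewrite mul1g mulg1.
rewrite !pgen_mul2; apply: cls_rel; apply: ChineseCom => /=.
rewrite /= ei ej; move: hij hi_ hj; rewrite !negb_and -!ltnNge.
move=> /orP[]/andP[h1 h2].
  by rewrite (ltnNge _ i) h1 (ltnNge _ j) h2 !orbF => -> ->.
by rewrite (ltnNge i) h1 (ltnNge j) h2 /= => -> ->.
Qed.

Lemma Celt_chinese b c (i k j : 'I_n) : i <= k <= j ->
  (Celt b c j * (Celt b c i * Celt b c k) =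
   Celt b c j * (Celt b c k * Celt b c i))%g /\
  (Celt b c j * (Celt b c k * Celt b c i) =
   Celt b c k * (Celt b c j * Celt b c i))%g.
Proof.
move=> /andP[ik kj].
have com1 : lo (c :: b) <= i ->
    (Celt b c j * Celt b c k = Celt b c k * Celt b c j)%g.
  move=> h; apply: Celt_com; rewrite orbC.
  by rewrite !(leq_trans h) // (leq_trans ik).
have com2 : j <= hi (c :: b) ->
    (Celt b c i * Celt b c k = Celt b c k * Celt b c i)%g.
  move=> h; apply: Celt_com; rewrite !(leq_trans _ h) //.
  by rewrite (leq_trans ik).
case: (boolP (lo (c :: b) <= i <= hi (c :: b))) => [u|nu].
  by rewrite (Celt_used u) !mul1g !mulg1 com1 //; case/andP: u.
case: (boolP (lo (c :: b) <= j <= hi (c :: b))) => [v|nv].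
  by rewrite (Celt_used v) !mul1g com2 //; case/andP: v.
case: (boolP (lo (c :: b) <= k <= hi (c :: b))) => [w|nw].
  by rewrite (Celt_used w) !mul1g !mulg1.
rewrite /Celt.
case: (insubP _ i) => [i' _ ei|]; last by rewrite negb_or -!leqNgt (negbTE nu).
case: (insubP _ j) => [j' _ ej|]; last by rewrite negb_or -!leqNgt (negbTE nv).
case: (insubP _ k) => [k' _ ek|]; last by rewrite negb_or -!leqNgt (negbTE nw).
rewrite !pgen_mul3; split; apply: cls_rel.
  by apply: Chinese1; rewrite /= ei ej ek ik.
by apply: Chinese2; rewrite /= ei ej ek ik.
Qed.

Lemma bqp : (bq * bp = 1 :> bicyclic)%g.
Proof.
by rewrite [LHS]pgen_mul2; exact: cls_rel BicyclicQP.
Qed.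

Lemma bicyclic_chinese (x i k j : nat) : i <= k <= j ->
  let f l := if l <= x then bp else bq in
  (f j * (f i * f k) = f j * (f k * f i))%g /\
  (f j * (f k * f i) = f k * (f j * f i))%g.
Proof.
move=> /andP[ik kj] /=.
case: (leqP j x) => hj.
  by rewrite !(leq_trans _ hj) // (leq_trans ik).
case: (leqP k x) => hk.
  by rewrite (leq_trans ik hk) /= !mulgA bqp mul1g -mulgA bqp mulg1.
case: (leqP i x) => hi_ //.
by rewrite /= bqp mulg1 mulgA bqp mul1g.
Qed.

Lemma step_elt_chinese c (i k j : 'I_n) : i <= k <= j ->
  (step_elt c j * (step_elt c i * step_elt c k) =
   step_elt c j * (step_elt c k * step_elt c i))%g /\
  (step_elt c j * (step_elt c k * step_elt c i) =
   step_elt c k * (step_elt c j * step_elt c i))%g.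
Proof.
move=> ikj.
have natC (u v : natM) : (u * v = v * u)%g by exact: addnC.
have intC (u v : intM) : (u * v = v * u)%g by exact: addrC.
case: c => [s|[x y]] /=.
  by split; [congr (_ * _)%g | rewrite !mulgA; congr (_ * _)%g]; apply: natC.
have [e1 e2] := bicyclic_chinese x ikj.
split; congr pair => //=.
  by congr (_ * _)%g; apply: intC.
by rewrite !mulgA; congr (_ * _)%g; apply: intC.
Qed.

Lemma step_elt_com b c (i j : 'I_n) :
  is_branch (c :: b) -> Ccom b i j ->
  (step_elt c i * step_elt c j = step_elt c j * step_elt c i)%g.
Proof.
have natC (u v : natM) : (u * v = v * u)%g by exact: addnC.
have intC (u v : intM) : (u * v = v * u)%g by exact: addrC.
case: c => [s|[x y]] /=; first by move=> _ _; apply: natC.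
case: b => [//|c b] /andP[br /and3P[_ /eqP ex _]] ij.
congr pair => /=; last exact: intC.
have xlo : x < lo (c :: b) by rewrite -ex.
have xhi : x <= hi (c :: b) := leq_trans (ltnW xlo) (lo_le_hi br).
case/orP: ij => /andP[]; first by rewrite -ex !ltnS => -> ->.
move=> h1 h2; rewrite (leqNgt i) (leqNgt j).
by rewrite (leq_ltn_trans xhi h1) (leq_ltn_trans xhi h2).
Qed.

(* psi is the homomorphism prescribed on generators. *)
Lemma psi_morphism b c : is_branch (c :: b) ->
  [/\ (forall i : Cgen b,
         psi c (pgen _ i) = (Celt b c (Cidx i), step_elt c (Cidx i))),
      psi c (1 : Cmon b)%g = 1%g
    & {morph @psi b c : x y / (x * y)%g >-> (x * y)%g}].
Proof.
move=> br; apply: extend_morphism => u v [i k j ikj|i k j ikj|i j ij];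
  rewrite !big_cons !big_nil !mulg1 /=.
- by congr pair; [case: (Celt_chinese b c ikj)|case: (step_elt_chinese c ikj)].
- by congr pair; [case: (Celt_chinese b c ikj)|case: (step_elt_chinese c ikj)].
congr pair; last exact: step_elt_com br ij.
apply: Celt_com; move: (Cidx i) (Cidx j) ij => {}i {}j; case: b br {u v} => [//|c' b] br.
have h1 := leq_trans (lo_le_hi (proj1 (andP br))) (hi_cons c (c' :: b)).
have h2 := leq_trans (lo_cons c (c' :: b)) (lo_le_hi (proj1 (andP br))).
case/orP=> /andP[h3 h4].
  by rewrite (leq_trans (ltnW h3) h1) (leq_trans (ltnW h4) h1).
by rewrite orbC (leq_trans h2 (ltnW h3)) (leq_trans h2 (ltnW h4)).
Qed.

(* A vertex d is reached by exactly one branch b (lemma [branch_unique]). *)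
Definition rho d (s t : chinese_monoid n) : Prop :=
  exists b, [/\ is_branch b, diag b = d & kappa b s = kappa b t].

End Rho.

(** * Ideals *)

Local Open Scope classical_set_scope.
Local Open Scope ring_scope.

Definition congr_ideal (K : fieldType) (M : monomType) (eta : M -> M -> Prop) :
  set {malg K[M]} :=
  [set x | exists r : seq (K * (M * M)),
     (forall e, e \in r -> eta e.2.1 e.2.2) /\
     x = \sum_(e <- r) e.1 *: (<< e.2.1 >> - << e.2.2 >>)].

Arguments congr_ideal K {M} eta.

Section Primes.
Variable A : pzRingType.
Implicit Types I J P Q : set A.

Definition two_sided_ideal I : Prop :=
  [/\ I 0, forall x y, I x -> I y -> I (x + y)
    & forall a x, I x -> I (a * x) /\ I (x * a)].

Definition prime_ideal P : Prop :=
  [/\ two_sided_ideal P, P <> setT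
    & forall I J, two_sided_ideal I -> two_sided_ideal J ->
        (forall x y, I x -> J y -> P (x * y)) -> I `<=` P \/ J `<=` P].

Definition minimal_prime P : Prop :=
  prime_ideal P /\ forall Q, prime_ideal Q -> Q `<=` P -> Q = P.

End Primes.

(* Main.v *)
(* For a pair [x < y] of indices, an "arc", sending the letters [<= x] to [p], the
   letters [>= y] to [q] and the others to [1] is a homomorphism from the Chinese
   monoid [M] to the bicyclic monoid, and all these homomorphisms together with the
   content separate the points of [M].  For a set [S] of arcs, let [I_S] be the ideal
   of the congruence "same content and same image under every arc of [S]".

   Let [P] be a prime and [S] a minimal set of arcs with [I_S] contained in [P].  If [S]
   contained two arcs that are not strictly nested, then [P] would contain
   [I_(S \ a)] or [I_(S \ b)] for one of these two arcs; so [S] is a chain for strict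
   nesting.  Conversely, if [S] is a chain, then [K[M]/I_S] acts faithfully on a tensor
   power of the standard representation of the bicyclic monoid, over a polynomial ring
   recording the contents; the image contains nonzero multiples of all matrix units,
   so [I_S] is prime.  Finally the arcs of the leaves of [D] are exactly the maximal
   chains, the dots filling the gaps, and [rho d] is the congruence of the arcs of
   the leaf [d].  Since [I_S <= I_S'] forces [S' <= S], these ideals are pairwise
   incomparable. *)
Require Import Defs.
From HB Require Import structures.
From mathcomp Require Import all_boot all_algebra zify.
From mathcomp Require Import finmap.
From mathcomp Require Import boolp classical_sets functions.
From mathcomp.multinomials Require mpoly.
From mathcomp.multinomials Require Import monalg.

Set Implicit Arguments.
Unset Strict Implicit.
Unset Printing Implicit Defensive.

Import GRing.Theory.

(** * Arcs and the bicyclic monoid *)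

(* The pair [(c, d)] is [p^c q^d]. *)
Definition bic : Type := (nat * nat)%type.
HB.instance Definition _ := Choice.on bic.

(** Truncated subtraction encodes the cancellation [q^d p^c' = p^(c'-d) q^(d-c')] coming from
    [qp = 1]. *)
Definition bic_mul (u v : bic) : bic := (u.1 + (v.1 - u.2), v.2 + (u.2 - v.1))%N.
Definition bic_one : bic := (0, 0)%N.

Lemma bic_mulA : associative bic_mul.
Proof. by move=> [a b] [c d] [e f]; rewrite /bic_mul /=; congr pair; lia. Qed.

Lemma bic_mul1 : left_id bic_one bic_mul.
Proof. by move=> [a b]; rewrite /bic_mul /=; congr pair; lia. Qed.

Lemma bic_mulr1 : right_id bic_one bic_mul.
Proof. by move=> [a b]; rewrite /bic_mul /=; congr pair; lia. Qed.

HB.instance Definition _ := isMonoid.Build bic bic_mulA bic_mul1 bic_mulr1.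

Lemma bicME (u v : bic) : (u * v)%g = (u.1 + (v.1 - u.2), v.2 + (u.2 - v.1))%N.
Proof. by []. Qed.

Lemma bic_eq (u v : bic) : u.1 = v.1 -> u.2 = v.2 -> u = v.
Proof. by case: u v => [? ?] [? ?] /= -> ->. Qed.

(** * Content and bicyclic images of elements of the Chinese monoid *)

Section ChineseStatistics.
Variable n : nat.
Implicit Types (a b : 'I_n * 'I_n) (l : 'I_n) (m s t : chinese_monoid n).
Implicit Types (w : seq 'I_n) (S : {set 'I_n * 'I_n}).

(* Locked, since unification would otherwise unfold products to classes of words. *)
Fact cword_key : unit. Proof. by []. Qed.
Definition cword w : chinese_monoid n := locked_with cword_key (cls _) w.
Definition cgen l : chinese_monoid n := cword [:: l].

Lemma cwordE w : cword w = cls _ w.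
Proof. by rewrite /cword unlock. Qed.

Lemma cword_repr m : cword (repr m) = m.
Proof. by rewrite cwordE; exact: cls_repr. Qed.

Lemma cword_cat w1 w2 : cword (w1 ++ w2) = (cword w1 * cword w2)%g.
Proof. by rewrite !cwordE; exact: cls_cat. Qed.

Lemma cword0 : cword [::] = 1%g.
Proof. exact: cwordE. Qed.

Lemma cword_cons l w : cword (l :: w) = (cgen l * cword w)%g.
Proof. exact: (cword_cat [:: l]). Qed.

Lemma chinese_ind (P : chinese_monoid n -> Prop) :
  P 1%g -> (forall l m, P m -> P (cgen l * m)%g) -> forall m, P m.
Proof.
move=> P1 Pl m; rewrite -(cword_repr m); elim: (repr m) => [|l w IH]; first by rewrite cword0.
by rewrite cword_cons; apply: Pl.
Qed.

Definition arc_letter a l : bic :=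
  if (l <= a.1)%N then (1, 0)%N else if (a.2 <= l)%N then (0, 1)%N else (0, 0)%N.

Definition bev a m : bic := extend (arc_letter a) m.

(** The Chinese relations hold for the letter images: if [i] goes to [p] and [j] to [q], all three
    words reduce to the image of [k]; otherwise the three images commute. *)
Lemma bev_cword a w : bev a (cword w) = (\prod_(l <- w) arc_letter a l)%g.
Proof.
rewrite cwordE; apply: extend_cls => u v; case=> // i k j /andP[ik kj].
all: have {}ik : (i <= k)%N := ik; have {}kj : (k <= j)%N := kj.
all: rewrite !big_cons !big_nil !mulg1 /arc_letter !bicME.
all: by do 6?[case: leqP => ? /=]; congr pair; lia.
Qed.

Lemma bev_gen a l : bev a (cgen l) = arc_letter a l.
Proof. by rewrite bev_cword big_seq1. Qed.

Lemma bev1 a : bev a 1%g = 1%g.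
Proof. by rewrite -cword0 bev_cword big_nil. Qed.

Lemma bevM a s t : bev a (s * t)%g = (bev a s * bev a t)%g.
Proof.
by rewrite -(cword_repr s) -(cword_repr t) -cword_cat !bev_cword big_cat.
Qed.

Definition cnt m l : nat := count_mem l (repr m).

Lemma cnt_cword w l : cnt (cword w) l = count_mem l w.
Proof.
rewrite /cnt cwordE; have /clsP := cls_repr (cls _ w : chinese_monoid n).
move: (repr _) => u; elim=> {u w} //.
- by move=> l' r u v Ruv; rewrite !count_cat; case: Ruv => //= *; lia.
- by move=> u v w _ -> _ ->.
Qed.

Lemma cntM s t l : cnt (s * t)%g l = (cnt s l + cnt t l)%N.
Proof.
by rewrite -(cword_repr s) -(cword_repr t) -cword_cat !cnt_cword count_cat.
Qed.

Lemma cnt1 l : cnt 1%g l = 0%N.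
Proof. by rewrite -cword0 cnt_cword. Qed.

Lemma cnt_gen k l : cnt (cgen k) l = (k == l).
Proof. by rewrite cnt_cword /= addn0. Qed.

Definition pcount a m : nat := (\sum_(l < n) (l <= a.1) * cnt m l)%N.
(** The conjunct [a.1 < l] mirrors the order of the tests in [arc_letter], so that [bev_balance]
    holds for arbitrary pairs. *)
Definition qcount a m : nat := (\sum_(l < n) ((a.1 < l) && (a.2 <= l)) * cnt m l)%N.

Lemma pcountM a s t : pcount a (s * t)%g = (pcount a s + pcount a t)%N.
Proof. by rewrite /pcount -big_split; apply: eq_bigr => l _; rewrite /= cntM mulnDr. Qed.

Lemma qcountM a s t : qcount a (s * t)%g = (qcount a s + qcount a t)%N.
Proof. by rewrite /qcount -big_split; apply: eq_bigr => l _; rewrite /= cntM mulnDr. Qed.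

Lemma pcount_gen a k : pcount a (cgen k) = (k <= a.1).
Proof.
rewrite /pcount (bigD1 k) //= cnt_gen eqxx muln1 big1 ?addn0 // => l.
by rewrite eq_sym cnt_gen => /negbTE->; rewrite muln0.
Qed.

Lemma qcount_gen a k : qcount a (cgen k) = ((a.1 < k) && (a.2 <= k)).
Proof.
rewrite /qcount (bigD1 k) //= cnt_gen eqxx muln1 big1 ?addn0 // => l.
by rewrite eq_sym cnt_gen => /negbTE->; rewrite muln0.
Qed.

(** This is the homomorphism [p^c q^d |-> c - d] to the integers, written without subtraction. *)
Lemma bev_balance a m : ((bev a m).1 + qcount a m = (bev a m).2 + pcount a m)%N.
Proof.
elim/chinese_ind: m => [|l m IH].
  by rewrite bev1 /pcount /qcount !big1 // => l _; rewrite cnt1 muln0.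
rewrite bevM pcountM qcountM bev_gen pcount_gen qcount_gen bicME /arc_letter.
case: leqP => _ /=; first lia.
by case: leqP => _ /=; lia.
Qed.

Lemma pcount_cnt a s t : cnt s =1 cnt t -> pcount a s = pcount a t.
Proof. by move=> e; apply: eq_bigr => l _; rewrite e. Qed.

Lemma qcount_cnt a s t : cnt s =1 cnt t -> qcount a s = qcount a t.
Proof. by move=> e; apply: eq_bigr => l _; rewrite e. Qed.

(** For elements of equal content, the two images differ by adding the same integer to both
    exponents; equality of one exponent is therefore enough. *)
Lemma bev_cnt a s t : cnt s =1 cnt t ->
  ((bev a s).1 + (bev a t).2 = (bev a t).1 + (bev a s).2)%N.
Proof.
move=> e; have := bev_balance a s; have := bev_balance a t.
rewrite (pcount_cnt a e) (qcount_cnt a e); lia.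
Qed.

Definition left_shift b a : bool := [&& b.1 <= a.1, b.2 <= a.2 & b != a]%N.

(** When [b] is a left shift of [a] and both are arcs, these are exactly the letters to which [a]
    and [b] give different images. *)
Definition shift_letter b a l : bool := (b.1 < l <= a.1)%N || (b.2 <= l < a.2)%N.

(** Letter by letter, the [p]s minus the [q]s for [a] are at least those for [b], with a strict gain
    at every shift letter. *)
Lemma shift_letter_count b a m l : (a.1 < a.2)%N -> (b.1 < b.2)%N ->
  (b.1 <= a.1)%N -> (b.2 <= a.2)%N -> shift_letter b a l ->
  (pcount b m + qcount a m + cnt m l <= pcount a m + qcount b m)%N.
Proof.
move=> ha hb h1 h2 hl.
have -> : cnt m l = \sum_(k < n) (k == l) * cnt m k.
  by rewrite (bigD1 l) //= eqxx mul1n big1 ?addn0 // => k /negbTE->.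
rewrite /pcount /qcount -!big_split; apply: leq_sum => k _ /=.
rewrite -!mulnDl leq_mul2r; apply/orP; right.
case: eqP => [->|_]; last by do 6?[case: leqP => ? //=]; lia.
by move: hl; rewrite /shift_letter; do 6?[case: leqP => ? //=]; lia.
Qed.

Lemma bev_shift b a m : (a.1 < a.2)%N -> (b.1 < b.2)%N ->
  (b.1 <= a.1)%N -> (b.2 <= a.2)%N ->
  (forall l, shift_letter b a l -> cnt m l = 0%N) -> bev a m = bev b m.
Proof.
move=> ha hb h1 h2; elim/chinese_ind: m => [_|l m IH hm]; first by rewrite !bev1.
rewrite !bevM !bev_gen; have -> : bev a m = bev b m.
  by apply: IH => k /hm; rewrite cntM; lia.
congr (_ * _)%g; have nl : ~~ shift_letter b a l.
  by apply/negP => /hm; rewrite cntM cnt_gen eqxx.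
by move: nl; rewrite /shift_letter /arc_letter; do 6?[case: leqP => ? //=]; lia.
Qed.

Definition arc_congr S s t : Prop := cnt s =1 cnt t /\ {in S, forall a, bev a s = bev a t}.

Lemma arc_congr_sym S s t : arc_congr S s t -> arc_congr S t s.
Proof. by case=> h1 h2; split=> [l|a /h2]. Qed.

Lemma arc_congr_trans S s t m : arc_congr S s t -> arc_congr S t m -> arc_congr S s m.
Proof.
case=> h1 h2 [h3 h4]; split=> [l|a aS]; first by rewrite h1 h3.
by rewrite h2 ?h4.
Qed.

Lemma arc_congrS S S' s t : S' \subset S -> arc_congr S s t -> arc_congr S' s t.
Proof. by move=> /fintype.subsetP sS [h1 h2]; split=> // a /sS/h2. Qed.

End ChineseStatistics.

(** * Normal form in the Chinese monoid *)

Lemma perm_prodg (I : eqType) (G : monoidType) (F : I -> G) (s1 s2 : seq I) :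
  {in s1 &, forall i j, commute (F i) (F j)} -> perm_eq s1 s2 ->
  (\prod_(i <- s1) F i = \prod_(i <- s2) F i)%g.
Proof.
elim: s1 s2 => [|i s1 IH] s2 cF p.
  by have /eqP := perm_size p; rewrite eq_sym size_eq0 => /eqP->.
have is2 : i \in s2 by rewrite -(perm_mem p) mem_head.
case/splitPr: is2 p => u v p; have {}p : perm_eq s1 (u ++ v).
  by rewrite -(perm_cons i) (perm_trans p) // -cat1s perm_catCA.
rewrite big_cons (IH _ _ p); last first.
  by move=> j k js ks; apply: cF; rewrite inE ?js ?ks orbT.
rewrite !big_cat big_cons /= !mulgA; congr (_ * _)%g; symmetry.
rewrite big_seq; apply: commute_sym; apply: commute_prod => j ju.
apply: cF; rewrite ?mem_head // inE (perm_mem p) mem_cat ju orbT //.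
Qed.

Section NormalForm.
Variable n : nat.
Implicit Types (a : 'I_n * 'I_n) (i k j l : 'I_n) (s t : chinese_monoid n).
Implicit Types (w : seq 'I_n).

Lemma cword3 i k j : cword [:: i; k; j] = (cgen i * cgen k * cgen j)%g.
Proof. by rewrite cword_cons (cword_cat [:: k] [:: j]) mulgA. Qed.

Lemma chinese1 i k j : (i <= k <= j)%N ->
  (cgen j * cgen i * cgen k = cgen j * cgen k * cgen i)%g.
Proof.
move=> h; rewrite -!cword3 !cwordE.
exact: (cls_rel (@Chinese1 _ val (fun _ _ => false) i k j h)).
Qed.

Lemma chinese2 i k j : (i <= k <= j)%N ->
  (cgen j * cgen k * cgen i = cgen k * cgen j * cgen i)%g.
Proof.
move=> h; rewrite -!cword3 !cwordE.
exact: (cls_rel (@Chinese2 _ val (fun _ _ => false) i k j h)).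
Qed.

(** The whole normal form rests on this: a pair [a_j a_i] commutes with every letter between its two
    indices. *)
Lemma pair_comm i k j : (i <= k <= j)%N ->
  commute (cgen j * cgen i)%g (cgen k).
Proof. by move=> h; rewrite /commute chinese1 // chinese2 // mulgA. Qed.

Lemma pair_comm_pair i i' k : (i <= k)%N -> (i' <= k)%N ->
  commute (cgen k * cgen i)%g (cgen k * cgen i')%g.
Proof.
wlog ii : i i' / (i <= i')%N.
  move=> h hi hi'; case: (leqP i i') => [/h|/ltnW/h]; first exact.
  by move=> h'; apply: commute_sym; apply: h'.
by move=> hi hi'; apply: commuteM; apply: pair_comm; rewrite ?hi ?ii ?leqnn.
Qed.

(** One column of the canonical form of the Chinese monoid is split off on the right. Letters are
    appended one at a time and sorted into the column, possibly expelling a letter smaller than [k]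
    to the left. *)
Lemma column_form k w : all (fun l : 'I_n => l <= k)%N w ->
  exists w' r e, [/\ all (fun l : 'I_n => l < k)%N w',
    all (fun l : 'I_n => l < k)%N r &
    cword w = (cword w' * (\prod_(i <- r) (cgen k * cgen i) * cgen k ^+ e))%g].
Proof.
elim/last_ind: w => [_|w l IH].
  by exists [::], [::], 0%N; split=> //; rewrite big_nil !mulg1.
rewrite all_rcons => /andP[lk /IH[w' [r [e [aw ar E]]]]] {IH}.
have Er : cword (rcons w l) = (cword w * cgen l)%g by rewrite -cats1 cword_cat.
move: lk; rewrite leq_eqVlt => /orP[/eqP lk|lk].
  exists w', r, e.+1; split=> //.
  by rewrite Er E expgSr !mulgA; congr (_ * cgen _)%g; apply: val_inj.
have prc i j : i \in r -> (i <= j <= k)%N -> commute (cgen j) (cgen k * cgen i)%g.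
  by move=> _ h; apply: commute_sym; apply: pair_comm.
case: e E => [|e] E.
  rewrite expg0 mulg1 in E.
  (* If all partners in the column are at most [l], then [a_l] commutes with every pair and moves
     left out of the column. *)
  have [/allP rl|/allPn[i0 i0r i0l]] := boolP (all (fun i : 'I_n => i <= l)%N r).
    exists (rcons w' l), r, 0%N; split; rewrite ?all_rcons ?lk //.
    rewrite Er E -cats1 cword_cat -!mulgA; congr (_ * _)%g.
    rewrite mulg1; symmetry; rewrite big_seq; apply: commute_prod => i ir.
    by apply: prc; rewrite // rl //= ltnW.
  (* Otherwise [l] replaces the largest partner [i], as [a_k a_i a_l = a_k a_l a_i]; by maximality
     of [i], the freed [a_i] commutes with all remaining pairs. *)
  have [i ir imax] : exists2 i, i \in r & {in r, forall i', i' <= i}%N.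
    case: (@arg_maxnP _ i0 (fun i => i \in r) val i0r) => i ir im.
    by exists i => // i' /im.
  have li : (l < i)%N by rewrite (leq_trans _ (imax _ i0r)) // ltnNge.
  have ik : (i < k)%N := allP ar i ir.
  have remr : {subset rem i r <= r} := mem_subseq (rem_subseq i r).
  exists (rcons w' i), (rcons (rem i r) l), 0%N; split.
  - by rewrite all_rcons ik.
  - by rewrite all_rcons lk; apply/allP => j /remr/(allP ar).
  rewrite Er E expg0 mulg1 -cats1 cword_cat -!mulgA; congr (_ * _)%g.
  have pri : perm_eq r (rcons (rem i r) i) by rewrite perm_sym perm_rcons perm_sym perm_to_rem.
  rewrite (perm_prodg _ pri); last first.
    by move=> j j' jr j'r; apply: pair_comm_pair; apply: ltnW; apply: (allP ar).
  rewrite -!cats1 !big_cat !big_seq1 /= -!mulgA.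
  have -> : (cgen k * (cgen i * cgen l) = cgen k * cgen l * cgen i)%g.
    by rewrite mulgA (@chinese1 l i k) // (ltnW li) (ltnW ik).
  rewrite !mulgA; have -> : (cgen i * \prod_(i <- rem i r) (cgen k * cgen i) =
      \prod_(i <- rem i r) (cgen k * cgen i) * cgen i)%g.
    rewrite big_seq; apply: commute_prod => j /remr jr.
    by apply: prc; rewrite // imax // ltnW.
  rewrite -!mulgA; congr (_ * _)%g; rewrite !mulgA.
  by rewrite -[RHS]mulgA; apply: pair_comm; rewrite (ltnW li) (ltnW ik).
(* With a free [a_k] available, the new letter pairs with it, and the pair commutes with the other
   powers of [a_k]. *)
exists w', (rcons r l), e; split; rewrite ?all_rcons ?lk //.
rewrite Er E -cats1 big_cat big_seq1 /= -!mulgA; congr (_ * (_ * _))%g.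
rewrite expgSr -mulgA [RHS]mulgA; symmetry.
by apply: commuteX; apply: pair_comm; rewrite leqnn ltnW.
Qed.

(** Here [a_k] goes to [q], so a pair [a_k a_i] gives [qp = 1], [q] or [q^2] according to whether
    [i] is at most [a.1], strictly between the ends, or at least [a.2]. *)
Lemma bev_column a k r e : (a.1 < a.2)%N -> (a.2 <= k)%N ->
  bev a (\prod_(i <- r) (cgen k * cgen i) * cgen k ^+ e)%g =
  (0, count (fun i : 'I_n => a.1 < i)%N r + count (fun i : 'I_n => a.2 <= i)%N r + e)%N.
Proof.
move=> ha hk; have kx : (k <= a.1)%N = false by lia.
have -> : bev a (\prod_(i <- r) (cgen k * cgen i) * cgen k ^+ e)%g =
    (bev a (\prod_(i <- r) (cgen k * cgen i))%g * ((0, e)%N : bic))%g.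
  rewrite bevM; congr (_ * _)%g; elim: e => [|e IH]; first by rewrite bev1.
  by rewrite expgS bevM IH bev_gen /arc_letter kx hk bicME /=; congr pair; lia.
elim: r => [|i r IH]; first by rewrite big_nil bev1 mul1g.
rewrite big_cons bevM -mulgA {}IH bevM !bev_gen /arc_letter kx hk !bicME /=.
by do 2?[case: leqP => ? /=]; congr pair; lia.
Qed.

Lemma bev_below a w : all (fun l : 'I_n => l < a.2)%N w -> (bev a (cword w)).2 = 0%N.
Proof.
elim: w => [_|l w IH]; first by rewrite bev_cword big_nil.
case/andP=> la /IH e; rewrite cword_cons bevM bev_gen bicME e /arc_letter.
by rewrite (leqNgt a.2) la; case: ifP.
Qed.

(** Multiplicities are differences of consecutive counts; for index 0 the size plays the role of the
    preceding count. *)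
Lemma count_gt_perm k r1 r2 : all (fun l : 'I_n => l < k)%N r1 ->
  all (fun l : 'I_n => l < k)%N r2 -> size r1 = size r2 ->
  (forall x : 'I_n, x < k ->
    count (fun i : 'I_n => x < i) r1 = count (fun i : 'I_n => x < i) r2)%N ->
  perm_eq r1 r2.
Proof.
move=> a1 a2 sz h; have {}h m : (m < k)%N ->
    count (fun i : 'I_n => m < i)%N r1 = count (fun i : 'I_n => m < i)%N r2.
  by move=> mk; apply: (h (Ordinal (ltn_trans mk (ltn_ord k)))).
have out l r : all (fun l : 'I_n => l < k)%N r -> (k <= l)%N -> count_mem l r = 0%N.
  move=> /allP ar kl; apply/count_memPn; apply/negP => /ar; lia.
have split l r : (0 < l)%N ->
    count (fun i : 'I_n => l.-1 < i)%N r =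
    (count_mem l r + count (fun i : 'I_n => l < i)%N r)%N.
  move=> l0; elim: r => //= i r ->.
  by have -> : (l.-1 < i)%N = (i == l) + (l < i)%N :> nat; [rewrite -val_eqE /=; lia|lia].
have split0 l (r : seq 'I_n) : l = 0%N :> nat ->
    size r = (count_mem l r + count (fun i : 'I_n => l < i)%N r)%N.
  move=> l0; elim: r => //= i r ->.
  have : 1%N = (i == l) + (l < i)%N :> nat by rewrite -val_eqE /=; lia.
  lia.
rewrite /perm_eq; apply/allP => l _ /=; apply/eqP.
case: (leqP k l) => kl; first by rewrite !out.
case: (posnP l) => l0.
  apply: (@addIn (count (fun i : 'I_n => l < i)%N r1)).
  by rewrite [in RHS](h l kl) -!split0.
apply: (@addIn (count (fun i : 'I_n => l < i)%N r1)).
by rewrite [in RHS](h l kl) -!split // (h l.-1 (leq_ltn_trans (leq_pred _) kl)).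
Qed.

(* Arcs with right end [k] read off the column of [k], which can then be
   cancelled in the bicyclic components of the smaller arcs. *)
Theorem bev_inj s t : cnt s =1 cnt t ->
  (forall a, (a.1 < a.2)%N -> bev a s = bev a t) -> s = t.
Proof.
rewrite -(cword_repr s) -(cword_repr t); move: (repr s) (repr t) => w1 w2 {s t} hc hb.
suff H (m : nat) : (m <= n)%N -> forall w1 w2, all (fun l : 'I_n => l < m)%N w1 ->
    all (fun l : 'I_n => l < m)%N w2 -> cnt (cword w1) =1 cnt (cword w2) ->
    (forall a, (a.1 < a.2)%N -> bev a (cword w1) = bev a (cword w2)) ->
    cword w1 = cword w2.
  by apply: (H n (leqnn n) w1 w2 _ _ hc hb); apply/allP => l _; apply: ltn_ord.
elim: m => [_ [|l u] [|l' v]|k IH kn u1 u2] //.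
pose K := Ordinal kn => /(@column_form K)[v1 [r1 [e1 [av1 ar1 E1]]]].
case/(@column_form K)=> v2 [r2 [e2 [av2 ar2 E2]]]; rewrite {}E1 {}E2 => {}hc {}hb.
have vK v : all (fun l : 'I_n => l < k)%N v -> cnt (cword v) K = 0%N.
  move=> /allP av; rewrite cnt_cword; apply/count_memPn; apply/negP => /av /=; lia.
have cK r e : all (fun l : 'I_n => l < k)%N r ->
    cnt (\prod_(i <- r) (cgen K * cgen i) * cgen K ^+ e)%g K = (size r + e)%N.
  have cX x d l : cnt (cgen x ^+ d)%g l = ((x == l) * d)%N.
    by elim: d => [|d IHd]; rewrite ?cnt1 ?muln0 // expgS cntM IHd cnt_gen mulnS.
  elim: r => [_|i r IHr /= /andP[ik /IHr er]]; first by rewrite big_nil mul1g cX eqxx mul1n.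
  rewrite big_cons -mulgA cntM er cntM !cnt_gen eqxx.
  by have -> : (i == K) = false; [rewrite -val_eqE /=; lia|lia].
have sz : (size r1 + e1 = size r2 + e2)%N.
  by have := hc K; rewrite (cntM (cword v1)) (cntM (cword v2)) !vK // !cK.
have gt (x : 'I_n) : (x < k)%N ->
    (count (fun i : 'I_n => x < i) r1 + e1 = count (fun i : 'I_n => x < i) r2 + e2)%N.
  move=> xk; have := hb (x, K) xk.
  rewrite (bevM _ (cword v1)) (bevM _ (cword v2)) !bev_column // !bicME.
  have nK r : all (fun l : 'I_n => l < k)%N r -> count (fun i : 'I_n => k <= i)%N r = 0%N.
    by move=> /allP ar; apply/eqP; rewrite -leqn0 leqNgt -has_count; apply/hasPn => i /ar; lia.
  by case=> _; rewrite !nK // !(@bev_below (x, K)) //=; lia.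
(* No partner exceeds [k.-1], so the arc [(k.-1, k)] sees only the free powers of [a_k]; for [k = 0]
   there are no partners. *)
have se : size r1 = size r2 /\ e1 = e2.
  case: (posnP k) => k0.
    have nil r : all (fun l : 'I_n => l < k)%N r -> r = [::] by rewrite k0; case: r.
    by move: sz; rewrite (nil r1) // (nil r2).
  have xn : (k.-1 < n)%N by lia.
  have := gt (Ordinal xn); rewrite /= => /(_ ltac:(lia)).
  have z r : all (fun l : 'I_n => l < k)%N r -> count (fun i : 'I_n => k.-1 < i)%N r = 0%N.
    by move=> /allP ar; apply/eqP; rewrite -leqn0 leqNgt -has_count; apply/hasPn => i /ar; lia.
  by rewrite !z //; lia.
case: se => ss ee; subst e2.
have pr : perm_eq r1 r2 by apply: (@count_gt_perm K) => // x /gt; lia.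
have ec : (\prod_(i <- r1) (cgen K * cgen i) = \prod_(i <- r2) (cgen K * cgen i))%g.
  apply: perm_prodg pr => i j ir jr.
  by apply: pair_comm_pair; apply: ltnW; apply: (allP ar1).
rewrite -{}ec in hc hb *; congr (_ * _)%g.
have hc' : cnt (cword v1) =1 cnt (cword v2).
  by move=> l; have := hc l; rewrite (cntM (cword v1)) (cntM (cword v2)); lia.
apply: IH => //; first exact: ltnW.
move=> a ha; have := bev_cnt a hc'; case: (leqP a.2 k) => ak.
  have := hb a ha; rewrite (bevM _ (cword v1)) (bevM _ (cword v2)) bev_column // !bicME.
  by move=> -[h1 h2] h3; apply: bic_eq; lia.
(* For [k < a.2] no letter of [v1] or [v2] goes to [q]: the second exponents vanish, and [bev_cnt]
   equates the first ones. *)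
have lt v : all (fun l : 'I_n => l < k)%N v -> all (fun l : 'I_n => l < a.2)%N v.
  by apply: sub_all => l; lia.
have b1 := bev_below (lt _ av1); have b2 := bev_below (lt _ av2).
by move=> h; apply: bic_eq; lia.
Qed.

End NormalForm.

(** * Prime ideals contain the ideal of a chain *)

Section PrimeElements.
Variables (A : pzRingType) (T : Type) (emb : T -> A).
Implicit Types (P : set A) (x y : A).
Local Open Scope ring_scope.

Lemma ideal_opp P x : two_sided_ideal P -> P x -> P (- x).
Proof. by case=> _ _ h /(h (-1))[]; rewrite mulN1r. Qed.

(** If [x A y] lies in [P], let [J] consist of the [v] with [x A v] in [P], and [I] of the [u] with
    [u A J] in [P]. These are ideals with [I J] in [P], [x] in [I] and [y] in [J]. The hypothesis on
    [emb] lets the middle factor be taken in the monoid. *)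
Lemma prime_elements P x y :
  (forall u v, (forall m, P (u * emb m * v)) -> forall a, P (u * a * v)) ->
  prime_ideal P -> ~ P x -> ~ P y -> exists m, ~ P (x * emb m * y).
Proof.
move=> span [idP _ primeP] nx ny; apply: contrapT => hxy.
have [P0 PD PM] := idP.
have {}hxy a : P (x * a * y).
  by apply: span => m; apply: contrapT => h; apply: hxy; exists m.
pose J : set A := fun v => forall a, P (x * a * v).
pose I : set A := fun u => forall v, J v -> forall a, P (u * a * v).
have idJ : two_sided_ideal J.
  split=> [a|u v Ju Jv a|b u Ju]; first by rewrite mulr0.
    by rewrite mulrDr; apply: PD.
  split=> a; first by rewrite mulrA -(mulrA x); apply: Ju.
  by rewrite mulrA; case: (PM b _ (Ju a)).
have idI : two_sided_ideal I.
  split=> [v _ a|u v Iu Iv w Jw a|b u Iu]; first by rewrite !mul0r.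
    by rewrite !mulrDl; apply: PD; [apply: Iu|apply: Iv].
  split=> v Jv a; first by rewrite -!mulrA; case: (PM b _ (Iu v Jv a)); rewrite !mulrA.
  by rewrite -(mulrA u); apply: Iu.
have [|hI|hJ] := primeP I J idI idJ.
- by move=> u v Iu /Iu/(_ 1); rewrite mulr1.
- by apply: nx; apply: hI => v; apply.
- by apply: ny; apply: hJ.
Qed.

End PrimeElements.

(** * Removing arcs that are not strictly nested *)

Section PrimesContainChains.
Variables (n : nat) (A : pzRingType) (emb : chinese_monoid n -> A) (P : set A).
Local Open Scope ring_scope.
Hypotheses (embM : forall s t, emb (s * t)%g = emb s * emb t) (emb1 : emb 1%g = 1).
Hypothesis span :
  forall u v, (forall m, P (u * emb m * v)) -> forall a, P (u * a * v).
Hypothesis primeP : prime_ideal P.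
Implicit Types (m s t : chinese_monoid n) (x y : A) (a b : 'I_n * 'I_n).
Implicit Types (S : {set 'I_n * 'I_n}).

Definition merges S : Prop := forall s t, arc_congr S s t -> P (emb s - emb t).

Let prime_mid x y : ~ P x -> ~ P y -> exists m, ~ P (x * emb m * y).
Proof. exact: prime_elements. Qed.

Definition nested b a : bool := (a.1 < b.1)%N && (b.2 < a.2)%N.

Definition arc_chain S : bool :=
  [forall a in S, (a.1 < a.2)%N] &&
  [forall a in S, forall b in S, [|| a == b, nested a b | nested b a]].

Lemma not_chain S : [forall a in S, (a.1 < a.2)%N] -> ~~ arc_chain S ->
  exists a b, [/\ a \in S, b \in S & left_shift b a].
Proof.
move=> hS; rewrite /arc_chain hS /= => /forallPn[a]; rewrite negb_imply => /andP[aS].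
case/forallPn=> b; rewrite negb_imply => /andP[bS].
rewrite /nested /left_shift; case: eqP => //= ab h.
case: (leqP b.1 a.1) (leqP b.2 a.2) => [h1|h1] [h2|h2].
- by exists a, b; split=> //; rewrite h1 h2 /= eq_sym; apply/eqP.
- case: (leqP a.1 b.1) => h3; last by move: h; rewrite h3 h2.
  by exists b, a; split=> //; rewrite h3 (ltnW h2) /=; apply/eqP.
- case: (leqP a.2 b.2) => h3; last by move: h; rewrite h3 h1 orbT.
  by exists b, a; split=> //; rewrite (ltnW h1) h3 /=; apply/eqP.
- by exists b, a; split=> //; rewrite (ltnW h1) (ltnW h2) /=; apply/eqP.
Qed.

(** Primeness supplies a middle factor [w] that keeps the product [a_l w u x] outside [P], so
    occurrences of [l] can be accumulated. *)
Lemma many_letters x (l : 'I_n) (N : nat) : ~ P x ->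
  ~ P (emb (cgen l)) -> exists u, ~ P (emb u * x) /\ (N <= cnt u l)%N.
Proof.
move=> nx nl; elim: N => [|N [u [nu hu]]].
  by exists 1%g; rewrite emb1 mul1r.
have [w nw] := prime_mid nl nu.
exists (cgen l * (w * u))%g; split; first by rewrite !embM !mulrA in nw *.
by rewrite !cntM cnt_gen eqxx; lia.
Qed.

(* A pair of [arc_congr (S :\ a)] is merged by a factor on its right having enough
   unmatched [p]s at [a], and one of [arc_congr (S :\ b)] by a factor on its left having
   enough unmatched [q]s at [b].  As [pcount b <= pcount a] and [qcount a <= qcount b],
   one of the two occurs between the factors, once the middle factor contains
   sufficiently many letters on which [a] and [b] disagree. *)
Lemma separate_shift S a b : merges S -> [forall c in S, (c.1 < c.2)%N] ->
  a \in S -> b \in S -> left_shift b a ->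
  merges (S :\ a) \/
  merges (S :\ b).
Proof.
move=> eP /forall_inP arcS aS bS /and3P[h1 h2 ba].
have ha := arcS a aS; have hb := arcS b bS.
have [idP _ _] := primeP; have [P0 PD PM] := idP.
apply: contrapT => /not_orP[na nb].
have {na} [s [t [st nst]]] : exists s t, arc_congr (S :\ a) s t /\ ~ P (emb s - emb t).
  apply: contrapT => h; apply: na => s t st.
  by apply: contrapT => nP; apply: h; exists s, t.
have {nb} [s' [t' [st' nst']]] : exists s t, arc_congr (S :\ b) s t /\ ~ P (emb s - emb t).
  apply: contrapT => h; apply: nb => s' t' st'.
  by apply: contrapT => nP; apply: h; exists s', t'.
(* Once all trailing [q]s of [s] and [t] at [a] are absorbed by [v], only the difference of
   exponents matters, and equal content makes it the same for both. *)
have merge_a v : (maxn (bev a s).2 (bev a t).2 <= (bev a v).1)%N ->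
    P ((emb s - emb t) * emb v).
  move=> hv; rewrite mulrBl -!embM; apply: eP; case: st => e1 e2.
  split=> [l|c cS]; first by rewrite !cntM e1.
  rewrite !bevM; have [->|ca] := eqVneq c a; last by rewrite e2 // !inE ca.
  by rewrite !bicME; have := bev_cnt a e1; move=> *; congr pair; lia.
have merge_b v : (maxn (bev b s').1 (bev b t').1 <= (bev b v).2)%N ->
    P (emb v * (emb s' - emb t')).
  move=> hv; rewrite mulrBr -!embM; apply: eP; case: st' => e1 e2.
  split=> [l|c cS]; first by rewrite !cntM e1.
  rewrite !bevM; have [->|cb] := eqVneq c b; last by rewrite e2 // !inE cb.
  by rewrite !bicME; have := bev_cnt b e1; move=> *; congr pair; lia.
(* If [P] contained all shift letters, it would contain every element in which one occurs; on the
   other elements [a] and [b] agree, so [s'] and [t'] would already be merged through [S]. *)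
have [l hl nl] : exists2 l, shift_letter b a l & ~ P (emb (cgen l)).
  apply: contrapT => h.
  have inP m l : shift_letter b a l -> cnt m l != 0%N -> P (emb m).
    move=> hl; have Pl : P (emb (cgen l)).
      by apply: contrapT => nl; apply: h; exists l.
    elim/chinese_ind: m => [|k m IH]; first by rewrite cnt1.
    rewrite cntM cnt_gen embM; case: (k =P l) => [->|_] /=; first by case: (PM (emb m) _ Pl).
    by move=> /IH Pm; case: (PM (emb (cgen k)) _ Pm).
  case: st' => e1 e2; have [z|nz] := pselect (forall l, shift_letter b a l -> cnt s' l = 0%N).
    apply: nst'; apply: eP; split=> // c cS.
    have [->|cb] := eqVneq c b; last by rewrite e2 // !inE cb.
    rewrite -!(bev_shift ha hb h1 h2) ?e2 //; first by rewrite !inE eq_sym ba.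
    by move=> l /z; rewrite e1.
  have [l hl] : exists2 l, shift_letter b a l & cnt s' l <> 0%N.
    by apply: contrapT => h'; apply: nz => l hl; apply: contrapT => nl; apply: h'; exists l.
  move=> /eqP zl; apply: nst'; apply: PD; first exact: inP zl.
  by apply: ideal_opp => //; apply: (inP _ l) => //; rewrite -e1.
pose D := maxn (bev a s).2 (bev a t).2.
pose C := maxn (bev b s').1 (bev b t').1.
(* The bound on occurrences of [l] is what [Cb], [Da], the two balances and [shift_letter_count]
   contradict together. *)
have [u [nu hu]] := many_letters (D + C + pcount b s + qcount a s') nst' nl.
have [w nw] := prime_mid nst nu.
have nwu : ~ P ((emb s - emb t) * emb (w * u)%g * (emb s' - emb t')).
  by rewrite embM !mulrA in nw *.
(* Since [s] and [t] agree at [b], enough trailing [q]s in [s (w u)] would let [merge_b] put both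
   terms of the expanded product in [P]. [Da] is the mirror argument. *)
have Cb : ((bev b (s * (w * u))%g).2 < C)%N.
  rewrite ltnNge; apply/negP => hC; apply: nwu; rewrite mulrBl mulrBl -!embM.
  apply: PD; [|apply: ideal_opp => //]; apply: merge_b => //.
  by rewrite bevM -(st.2 b) ?inE ?ba // -bevM.
have Da : ((bev a (w * u * s')%g).1 < D)%N.
  rewrite ltnNge; apply/negP => hD; apply: nwu; rewrite -mulrA mulrBr -!embM mulrBr.
  apply: PD; [|apply: ideal_opp => //]; apply: merge_a => //.
  by rewrite bevM -(st'.2 a) ?inE ?(eq_sym a) ?ba // -bevM.
have := shift_letter_count (w * u)%g ha hb h1 h2 hl.
have := bev_balance b (s * (w * u))%g; have := bev_balance a (w * u * s')%g.
rewrite (pcountM _ s) (qcountM _ s) (pcountM _ _ s') (qcountM _ _ s') (cntM w u); lia.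
Qed.

(** By [bev_inj] the set of all arcs merges only equal elements, so some set of arcs qualifies; one
    of least cardinality is a chain, since [separate_shift] would shrink it. *)
Theorem prime_merges_chain :
  exists2 S, arc_chain S & merges S.
Proof.
pose Q S := [forall c in S, (c.1 < c.2)%N] && `[<  merges S >].
have [[P0 _ _] _ _] := primeP.
have Q0 : Q [set a : 'I_n * 'I_n | (a.1 < a.2)%N].
  apply/andP; split; first by apply/forall_inP => a; rewrite inE.
  apply/asboolP => s t [e1 e2].
  by rewrite (bev_inj e1) ?subrr // => a ha; apply: e2; rewrite inE.
case: (arg_minnP (fun S : {set 'I_n * 'I_n} => #|S|) Q0) => S /andP[arcS /asboolP PS] minS.
exists S => //; apply/negPn/negP => /(not_chain arcS)[a [b [aS bS ba]]].
have arcD c : [forall d in S :\ c, (d.1 < d.2)%N].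
  by apply/forall_inP => d; rewrite inE => /andP[_]; apply: (forall_inP arcS).
have less c : c \in S -> ~ merges (S :\ c).
  move=> cS hc; have /minS : Q (S :\ c) by rewrite /Q arcD; apply/asboolP.
  by rewrite (cardsD1 c S) cS; lia.
by case: (separate_shift PS arcS aS bS ba); apply: less.
Qed.

End PrimesContainChains.

(** * The ideal of a chain is prime *)

Section MonoidAlgebra.
Variables (K : fieldType) (M : monomType).
Local Notation A := {malg K[M]}.
Implicit Types (m s t : M) (x y : A) (P : set A).

Local Open Scope ring_scope.

Lemma malg_genM s t : (<< s >> * << t >> : A) = << mmul s t >>.
Proof. by rewrite malgM_def fgmulUU mulr1. Qed.

Lemma malg_sum x : x = \sum_(m <- enum_fset (msupp x)) mcoeff m x *: << m >>.
Proof.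
rewrite {1}[x]monalgE; apply: eq_bigr => m _.
by apply/malgP => k; rewrite mcoeffZ !mcoeffU mulrnAr mulr1.
Qed.

Lemma malg_scaler_gen (c : K) m : c *: << m >> = << c *g m >> :> A.
Proof. by apply/malgP => k; rewrite mcoeffZ !mcoeffU mulrnAr mulr1. Qed.

Lemma malg_scalerAr (c : K) x y : x * (c *: y) = c *: (x * y).
Proof.
rewrite [x]malg_sum !mulr_suml scaler_sumr; apply: eq_bigr => m _.
rewrite -!scalerAl scalerA mulrC -scalerA; congr (_ *: _).
rewrite [y]malg_sum scaler_sumr !mulr_sumr scaler_sumr; apply: eq_bigr => k _.
rewrite scalerA !malg_scaler_gen !malgM_def !fgmulUU !mul1r.
by apply/malgP => j; rewrite mcoeffZ !mcoeffU mulrnAr.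
Qed.

Lemma ideal_scale P (c : K) x : two_sided_ideal P -> P x -> P (c *: x).
Proof. by case=> _ _ h /(h (c *: 1))[]; rewrite -scalerAl mul1r. Qed.

Lemma ideal_sum P (I : Type) (r : seq I) (F : I -> A) :
  two_sided_ideal P -> (forall i, P (F i)) -> P (\sum_(i <- r) F i).
Proof. by case=> P0 PD _ h; elim/big_ind: _ => //. Qed.

Lemma ideal_sum_seq P (I : eqType) (r : seq I) (F : I -> A) :
  two_sided_ideal P -> (forall i, i \in r -> P (F i)) -> P (\sum_(i <- r) F i).
Proof. by case=> P0 PD _ h; rewrite big_seq; elim/big_ind: _ => // i; apply: h. Qed.

Lemma malg_span P x y : two_sided_ideal P ->
  (forall m, P (x * << m >> * y)) -> forall a, P (x * a * y).
Proof.
move=> idP hP a; rewrite [a]malg_sum mulr_sumr mulr_suml; apply: ideal_sum => // m.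
by rewrite malg_scalerAr -scalerAl; apply: ideal_scale.
Qed.

Lemma congr_ideal_gen (R : M -> M -> Prop) s t :
  R s t -> congr_ideal K R (<< s >> - << t >>).
Proof.
move=> h; exists [:: (1, (s, t))]; rewrite big_seq1 scale1r; split=> // e.
by rewrite inE => /eqP->.
Qed.

Lemma congr_ideal_sub (R : M -> M -> Prop) P : two_sided_ideal P ->
  (forall s t, R s t -> P (<< s >> - << t >>)) ->
  (congr_ideal K R `<=` P)%classic.
Proof.
move=> idP h x [r [hr ->]]; apply: ideal_sum_seq => // e /hr he.
by apply: ideal_scale => //; apply: h.
Qed.

Lemma congr_ideal_two_sided (R : M -> M -> Prop) :
  (forall m s t, R s t -> R (mmul m s) (mmul m t)) ->
  (forall m s t, R s t -> R (mmul s m) (mmul t m)) ->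
  two_sided_ideal (congr_ideal K R).
Proof.
move=> hl hr; set I := congr_ideal K R.
have I0 : I 0 by exists [::]; rewrite big_nil.
have ID x y : I x -> I y -> I (x + y).
  move=> [r1 [h1 ->]] [r2 [h2 ->]]; exists (r1 ++ r2); rewrite big_cat; split=> // e.
  by rewrite mem_cat => /orP[/h1|/h2].
have Isum (F : M -> A) (r : seq M) : (forall i, I (F i)) -> I (\sum_(i <- r) F i).
  by move=> h; elim/big_ind: _ => //.
split=> // a x [r [h ->]]; rewrite [a]malg_sum mulr_suml mulr_sumr; split; apply: Isum => m.
  exists [seq (mcoeff m a * e.1, (mmul m e.2.1, mmul m e.2.2)) | e <- r]; split.
    by move=> _ /mapP[e er ->] /=; apply/hl/h.
  rewrite big_map mulr_sumr; apply: eq_bigr => e _ /=.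
  by rewrite -scalerAl malg_scalerAr scalerA mulrBr !malg_genM.
exists [seq (mcoeff m a * e.1, (mmul e.2.1 m, mmul e.2.2 m)) | e <- r]; split.
  by move=> _ /mapP[e er ->] /=; apply/hr/h.
rewrite big_map mulr_suml; apply: eq_bigr => e _ /=.
by rewrite -scalerAl malg_scalerAr scalerA mulrC mulrBl !malg_genM.
Qed.

(** The linear functional that is 1 on the class of [t] and 0 on the other monoid elements kills the
    ideal. *)
Lemma congr_ideal_inv (R : M -> M -> Prop) s t : R t t ->
  (forall u v, R u v -> R u t <-> R v t) ->
  congr_ideal K R (<< s >> - << t >>) -> R s t.
Proof.
move=> Rtt Rt [r [hr]]; pose h m : K := (`[< R m t >])%:R.
move=> /(congr1 (mmap idfun h)); rewrite mmapB !mmapU /= !mul1r.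
rewrite raddf_sum big_seq big1 => [/eqP|e /hr he] /=; last first.
  by rewrite scalerBr !malg_scaler_gen mmapB !mmapU /= /h (asbool_equiv_eq (Rt _ _ he)) subrr.
rewrite subr_eq0 /h (asboolT Rtt); case: asboolP => // _.
by rewrite eq_sym oner_eq0.
Qed.

End MonoidAlgebra.

(** * Linear extension of a right action of the monoid to its algebra *)

Section RightAction.
Variables (K : fieldType) (M : monomType) (V : lmodType K) (act : M -> {linear V -> V}).
Hypothesis actM : forall s t v, act (mmul s t) v = act t (act s v).
Local Notation A := {malg K[M]}.
Implicit Types (m s t : M) (x y : A) (v : V).
Local Open Scope ring_scope.

Definition ract x v : V := \sum_(m <- enum_fset (msupp x)) mcoeff m x *: act m v.

Lemma ractEw (d : {fset M}) x v : fsubset (msupp x) d ->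
  ract x v = \sum_(m <- enum_fset d) mcoeff m x *: act m v.
Proof.
move=> sub; rewrite /ract (big_fset_incl _ sub) // => m _ /mcoeff_outdom->.
by rewrite scale0r.
Qed.

Lemma ractD x y v : ract (x + y) v = ract x v + ract y v.
Proof.
rewrite (ractEw _ (msuppD_le x y)).
rewrite (ractEw (d := fsetU (msupp x) (msupp y)) v (fsubsetUl _ _)).
rewrite (@ractEw (fsetU (msupp x) (msupp y)) y v (fsubsetUr _ _)) -big_split.
by apply: eq_bigr => m _; rewrite mcoeffD scalerDl.
Qed.

Lemma ract_scaled_gen c m v : ract << c *g m >> v = c *: act m v.
Proof.
rewrite (ractEw (d := fset1 m) v msuppU_le).
by rewrite big_seq_fset1 mcoeffUU.
Qed.

Lemma ract_gen m v : ract << m >> v = act m v.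
Proof. by rewrite ract_scaled_gen scale1r. Qed.

Lemma ractZ c x v : ract (c *: x) v = c *: ract x v.
Proof.
rewrite (ractEw v (msuppZ_le c x)) /ract scaler_sumr; apply: eq_bigr => m _.
by rewrite mcoeffZ scalerA.
Qed.

Lemma ractB x y v : ract (x - y) v = ract x v - ract y v.
Proof. by rewrite -(scaleN1r y) ractD ractZ scaleN1r. Qed.

Lemma ract_sum (I : Type) (r : seq I) (F : I -> A) v :
  ract (\sum_(i <- r) F i) v = \sum_(i <- r) ract (F i) v.
Proof.
elim: r => [|i r IH]; last by rewrite !big_cons ractD IH.
by rewrite !big_nil /ract msupp0 big_nil.
Qed.

Lemma ractM x y v : ract (x * y) v = ract y (ract x v).
Proof.
rewrite [y]malg_sum mulr_sumr !ract_sum; apply: eq_bigr => m _.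
rewrite malg_scalerAr !ractZ; congr (_ *: _); rewrite ract_gen.
rewrite [x]malg_sum mulr_suml !ract_sum linear_sum; apply: eq_bigr => s _.
by rewrite -scalerAl !ractZ linearZ !ract_gen -actM -ract_gen malg_genM.
Qed.

Lemma ract_congr (R : M -> M -> Prop) x v :
  (forall s t, R s t -> act s v = act t v) -> congr_ideal K R x -> ract x v = 0.
Proof.
move=> h [r [hr ->]]; rewrite ract_sum big_seq big1 // => e /hr he.
by rewrite ractZ ractB !ract_gen (h _ _ he) subrr scaler0.
Qed.

End RightAction.

(** * The tensor power of the bicyclic representation and primeness *)

Section BicyclicRepresentation.
Import mpoly.
Variables (K : fieldType) (M : monomType) (I : finType) (n : nat).
Variables (cont : M -> 'X_{1..n}) (bv : I -> M -> bic).
Hypothesis contM : forall s t, cont (mmul s t) = (cont s + cont t)%MM.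
Hypothesis bvM : forall i s t, bv i (mmul s t) = (bv i s * bv i t)%g.
Hypothesis bv_cont : forall i s t, cont s = cont t ->
  ((bv i s).1 + (bv i t).2 = (bv i t).1 + (bv i s).2)%N.

Local Open Scope ring_scope.
Local Notation A := {malg K[M]}.
Local Notation L := (mpoly n K).
Local Notation idx := {ffun I -> nat}.
Local Notation V := (idx -> L).
Implicit Types (m s t : M) (x y : A) (F : V) (p q l : idx) (i : I).

Definition stat_eq s t : Prop := cont s = cont t /\ forall i, bv i s = bv i t.

(* Row vectors over [L], indexed by the basis vectors [e_l] of the tensor product,
   over [I], of the standard representation of the bicyclic monoid: [p e_k = e_(k+1)],
   [q e_(k+1) = e_k] and [q e_0 = 0]. *)
Definition bact m F : V := fun l =>
  if [forall i, ((bv i m).2 <= l i)%N]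
  then 'X_[cont m] * F [ffun i => (l i - (bv i m).2 + (bv i m).1)%N] else 0.

Lemma bact_linear m : linear (bact m).
Proof.
move=> c F G; apply/funext => l; rewrite -[RHS]/(c *: bact m F l + bact m G l) /bact.
case: ifP => _; last by rewrite scaler0 addr0.
by rewrite -[(c *: F + G) _]/(c *: F _ + G _) mulrDr scalerAr.
Qed.

HB.instance Definition _ m :=
  GRing.isLinear.Build K V V *:%R (bact m) (bact_linear m).

Lemma bactM s t F : bact (mmul s t) F = bact t (bact s F).
Proof.
apply/funext => l; rewrite /bact contM.
have -> : [forall i, ((bv i (mmul s t)).2 <= l i)%N] =
    [forall i, ((bv i t).2 <= l i)%N] && [forall i, ((bv i s).2 <=
      [ffun i => (l i - (bv i t).2 + (bv i t).1)%N] i)%N].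
  apply/forallP/andP => [h|[/forallP h1 /forallP h2] i].
    by split; apply/forallP => i; have := h i; rewrite bvM bicME ?ffunE /=; lia.
  by have := h1 i; have := h2 i; rewrite ffunE bvM bicME /=; lia.
case: (boolP [forall i, ((bv i t).2 <= l i)%N]) => [/forallP h1|] //=.
case: ifP => [/forallP h2|_]; last by rewrite mulr0.
rewrite mpolyXD mulrA (mulrC 'X_[cont t]); congr (_ * F _).
apply/ffunP => i; rewrite !ffunE bvM !bicME /=.
by have := h1 i; have := h2 i; rewrite ffunE; lia.
Qed.

Definition ket p : V := fun l => (l == p)%:R.

Lemma stat_eq_bact s t F : stat_eq s t -> bact s F = bact t F.
Proof.
case=> e1 e2; apply/funext => l; rewrite /bact e1.
have -> : [forall i, ((bv i s).2 <= l i)%N] = [forall i, ((bv i t).2 <= l i)%N].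
  by apply: eq_forallb => i; rewrite e2.
by congr (if _ then _ * F _ else _); apply/ffunP => i; rewrite !ffunE e2.
Qed.

Lemma fct_scaleE (c : K) F l : (c *: F) l = c *: F l.
Proof. by []. Qed.

Let act : M -> {linear V -> V} := fun m => bact m.

(** Modulo the ideal, [x] is replaced by a combination [y] of chosen class representatives, nonzero
    and with pairwise inequivalent support. An element [s0] of the support with the least total
    [q]-exponent is then isolated. *)
Lemma ract_faithful x : ~ congr_ideal K stat_eq x ->
  exists p q, ract act x (ket p) q != 0.
Proof.
move=> nx; pose rep m := choose (fun t => `[< stat_eq m t >]) m.
have R_rep m : stat_eq m (rep m).
  by apply/asboolP; apply: (@chooseP _ (fun t => `[< stat_eq m t >])); apply/asboolP.
have rep_eq m t : stat_eq m t -> rep m = rep t.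
  move=> [e1 e2]; rewrite /rep.
  have e : (fun u => `[< stat_eq m u >]) =1 (fun u => `[< stat_eq t u >]).
    move=> u; apply/asboolP/asboolP => -[h1 h2]; split=> [|i]; rewrite -?h1 -?h2 ?e1 ?e2 //.
  rewrite (eq_choose e); apply: choose_id; apply/asboolP; split=> //.
pose y := \sum_(m <- enum_fset (monalg.msupp x)) monalg.mcoeff m x *: << rep m >>.
have Ixy : congr_ideal K stat_eq (x - y).
  exists [seq (monalg.mcoeff m x, (m, rep m)) | m <- enum_fset (monalg.msupp x)]; split.
    by move=> _ /mapP[m _ ->].
  rewrite big_map {1}[x]malg_sum /y -sumrB; apply: eq_bigr => m _ /=.
  by rewrite scalerBr.
have rxy v : ract act x v = ract act y v.
  apply/eqP; rewrite -subr_eq0 -ractB; apply/eqP.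
  by apply: (ract_congr _ Ixy) => s t; apply: stat_eq_bact.
have supp_rep m : m \in monalg.msupp y -> rep m = m.
  move=> my; have [k _ <-] : exists2 k, k \in enum_fset (monalg.msupp x) & rep k = m.
    apply: contrapT => h; move: my.
    rewrite -monalg.mcoeff_neq0 /y raddf_sum big_seq big1 ?eqxx //.
    move=> k kx /=; rewrite monalg.mcoeffZ monalg.mcoeffU; case: eqP => [e|_].
      by case: h; exists k.
    by rewrite mulr0.
  by symmetry; apply: rep_eq; apply: R_rep.
pose dsum m := (\sum_i (bv i m).2)%N.
have [s0 s0y s0min] : exists2 s, s \in monalg.msupp y &
    forall t, t \in monalg.msupp y -> (dsum s <= dsum t)%N.
  have /fset0Pn[s1 s1y] : monalg.msupp y != fset0.
    rewrite monalg.msupp_eq0; apply/eqP => y0; apply: nx.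
    by move: Ixy; rewrite y0 subr0.
  have ex : exists k, has (fun s => dsum s == k) (enum_fset (monalg.msupp y)).
    by exists (dsum s1); apply/hasP; exists s1.
  case: (ex_minnP ex) => k /hasP[s sy /eqP sk] kmin; exists s => // t ty.
  by rewrite sk; apply: kmin; apply/hasP; exists t.
(* At this entry and the monomial of [cont s0], another [m] contributes only with the same content
   and with [q]-exponents bounded by those of [s0]. Minimality makes them equal, and [bv_cont] then
   makes [m] equivalent to [s0]. *)
exists [ffun i => (bv i s0).1], [ffun i => (bv i s0).2].
set p := [ffun i => _]; set q := [ffun i => (bv i s0).2].
rewrite rxy; apply/eqP => /(congr1 (mcoeff (cont s0))); apply/eqP.
rewrite mcoeff0 /ract fct_sumE raddf_sum /=.
have c0 : mcoeff (cont s0) (bact s0 (ket p) q) = 1.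
  rewrite /bact ifT; last by apply/forallP => i; rewrite ffunE.
  rewrite /ket (_ : [ffun i => _] = p) ?eqxx ?mulr1 ?mcoeffX ?eqxx //.
  by apply/ffunP => i; rewrite !ffunE subnn.
rewrite (big_fsetD1 s0) //= fct_scaleE mcoeffZ c0 mulr1.
rewrite big_seq big1 ?addr0; first by rewrite monalg.mcoeff_neq0.
move=> m; rewrite in_fsetD1 => /andP[ms0 my].
rewrite fct_scaleE mcoeffZ /act /bact /=.
case: ifP => [/forallP h|_]; last by rewrite mcoeff0 mulr0.
rewrite /ket; case: (_ == p); last by rewrite mulr0 mcoeff0 mulr0.
rewrite mulr1 mcoeffX; case: eqP => [e|_]; last by rewrite mulr0.
have d i : (bv i m).2 = (bv i s0).2.
  apply/eqP; rewrite eqn_leq; have := h i; rewrite ffunE => -> /=.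
  rewrite leqNgt; apply/negP => lt; have := s0min m my; apply/negP; rewrite -ltnNge.
  rewrite /dsum (bigD1 i) //= [ltnRHS](bigD1 i) //= -addSn; apply: leq_add => //.
  by apply: leq_sum => j _; have := h j; rewrite ffunE.
have ms : stat_eq m s0.
  by split=> // i; apply: bic_eq => //; have := bv_cont i e; rewrite d; lia.
by case/eqP: ms0; rewrite -(supp_rep m my) -(supp_rep s0 s0y); apply: rep_eq.
Qed.

Variables (pi theta : I -> M).
Hypothesis bv_pi : forall i j, bv i (pi j) = (if i == j then (1, 0) else (0, 0))%N.
Hypothesis bv_theta : forall i j, bv i (theta j) = (if i == j then (0, 1) else (0, 0))%N.
Hypothesis bv1 : forall i, bv i (mone : M) = 1%g.

Lemma exists_raise p : exists m, forall i, bv i m = (p i, 0%N).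
Proof.
suff [m hm] : exists m, forall i, bv i m = (if i \in enum I then p i else 0%N, 0%N).
  by exists m => i; rewrite hm mem_enum.
have : uniq (enum I) by apply: enum_uniq.
elim: (enum I) => [_|j r IH /andP[jr /IH[m hm]]]; first by exists (mone : M) => i; rewrite bv1.
have [u hu] : exists u, forall i, bv i u = (if i == j then p j else 0%N, 0%N).
  elim: (p j) => [|k [u hu]]; first by exists (mone : M) => i; rewrite bv1; case: eqP.
  exists (mmul (pi j) u) => i; rewrite bvM hu bv_pi bicME.
  by case: eqP => _ /=; congr pair; lia.
exists (mmul u m) => i; rewrite bvM hu hm bicME inE.
by case: eqP => [->|_] /=; rewrite ?(negbTE jr) //=; congr pair; lia.
Qed.

Lemma exists_lower p : exists m, forall i, bv i m = (0%N, p i).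
Proof.
suff [m hm] : exists m, forall i, bv i m = (0%N, if i \in enum I then p i else 0%N).
  by exists m => i; rewrite hm mem_enum.
have : uniq (enum I) by apply: enum_uniq.
elim: (enum I) => [_|j r IH /andP[jr /IH[m hm]]]; first by exists (mone : M) => i; rewrite bv1.
have [u hu] : exists u, forall i, bv i u = (0%N, if i == j then p j else 0%N).
  elim: (p j) => [|k [u hu]]; first by exists (mone : M) => i; rewrite bv1; case: eqP.
  exists (mmul (theta j) u) => i; rewrite bvM hu bv_theta bicME.
  by case: eqP => _ /=; congr pair; lia.
exists (mmul u m) => i; rewrite bvM hu hm bicME inE.
by case: eqP => [->|_] /=; rewrite ?(negbTE jr) //=; congr pair; lia.
Qed.

Lemma bact1 F : bact (mone : M) F = F.
Proof.
apply/funext => l; rewrite /bact ifT; last by apply/forallP => i; rewrite bv1.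
have -> : cont (mone : M) = 0%MM.
  have := contM (mone : M) (mone : M); rewrite mul1m => /mnmP e.
  by apply/mnmP => i; have := e i; rewrite mnmDE mnm0E; lia.
rewrite mpolyX0 mul1r; congr F; apply/ffunP => i.
by rewrite ffunE bv1 /= subn0 addn0.
Qed.

(* In the bicyclic algebra [q p - p q] is the projection onto [e_0]. *)
Lemma exists_vacuum : exists x (c : L), c != 0 /\
  forall F, ract act x F = fun l => if [forall i, l i == 0%N] then c * F l else 0.
Proof.
suff [x [c [c0 hx]]] : exists x (c : L), c != 0 /\ forall F, ract act x F =
    fun l => if all (fun i => l i == 0%N) (enum I) then c * F l else 0.
  exists x, c; split=> // F; rewrite hx; apply/funext => l; congr (if _ then _ else _).
  by apply/allP/forallP => h i; [apply: h; rewrite mem_enum|move=> _; apply: h].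
elim: (enum I) => [|j r [x [c [c0 hx]]]].
  exists 1, 1; split=> [|F]; first exact: oner_neq0.
  by apply/funext => l /=; rewrite (ract_gen act (mone : M)) /act /= bact1 mul1r.
pose a := << mmul (theta j) (pi j) >> - << mmul (pi j) (theta j) >> : A.
have ha F : ract act a F = fun l =>
    if l j == 0%N then 'X_[cont (mmul (pi j) (theta j))] * F l else 0.
  rewrite ractB !ract_gen; apply/funext => l.
  rewrite -[LHS]/(bact (mmul (theta j) (pi j)) F l - bact (mmul (pi j) (theta j)) F l).
  rewrite {1}/bact ifT; last first.
    by apply/forallP => i; rewrite bvM bv_pi bv_theta bicME; case: eqP.
  have -> : [ffun i => (l i - (bv i (mmul (theta j) (pi j))).2 +
      (bv i (mmul (theta j) (pi j))).1)%N] = l.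
    by apply/ffunP => i; rewrite ffunE bvM bv_pi bv_theta bicME; case: eqP => _ /=; lia.
  have -> : cont (mmul (theta j) (pi j)) = cont (mmul (pi j) (theta j)).
    by rewrite !contM addmC.
  rewrite /bact; case: eqP => [lj|/eqP lj].
    rewrite ifF ?subr0 //; apply/negP => /forallP/(_ j).
    by rewrite bvM bv_pi bv_theta bicME eqxx lj.
  rewrite ifT; last first.
    apply/forallP => i; rewrite bvM bv_pi bv_theta bicME.
    by case: eqP => [->|_] //=; rewrite lt0n.
  apply/eqP; rewrite subr_eq0; apply/eqP; congr (_ * F _).
  apply/ffunP => i; rewrite ffunE bvM bv_pi bv_theta bicME.
  by case: eqP => [->|_] /=; lia.
exists (x * a), ('X_[cont (mmul (pi j) (theta j))] * c); split=> [|F].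
  by rewrite mulf_neq0 // -msupp_eq0 msuppX.
rewrite (ractM (act := act) bactM) ha hx; apply/funext => l /=.
by case: (l j == 0%N) => //=; case: ifP => _; rewrite ?mulr0 ?mulrA.
Qed.

(** The factor [u] brings coordinate [p] to the origin, [x] erases all other coordinates, and [v]
    carries the origin to [q]. *)
Lemma exists_matrix_unit p q : exists x (c : L), c != 0 /\
  forall F, ract act x F = fun l => c * F p * ket q l.
Proof.
have [u hu] := exists_raise p; have [v hv] := exists_lower q.
have [x [c [c0 hx]]] := exists_vacuum.
exists (<< u >> * x * << v >>), ('X_[cont v] * (c * 'X_[cont u])); split=> [|F].
  by rewrite !mulf_neq0 // -msupp_eq0 msuppX.
rewrite !(ractM (act := act) bactM) !ract_gen hx; apply/funext => l.
rewrite /act /= /bact /ket; case: eqP => [->|lq].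
  rewrite ifT; last by apply/forallP => i; rewrite hv.
  rewrite ifT; last by apply/forallP => i; rewrite ffunE hv subnn.
  rewrite ifT; last by apply/forallP => i; rewrite hu.
  rewrite mulr1 !mulrA; congr (_ * F _); apply/ffunP => i.
  by rewrite !ffunE hu hv /=; lia.
rewrite mulr0; case: ifP => // /forallP h1.
case: ifP => [/forallP h2|_]; last by rewrite mulr0.
case: lq; apply/ffunP => i; have := h1 i; have := h2 i; rewrite ffunE hv /=; lia.
Qed.

Lemma ract_scaleL x (c : L) p l :
  ract act x (fun k => c * ket p k) l = c * ract act x (ket p) l.
Proof.
rewrite /ract !fct_sumE mulr_sumr; apply: eq_bigr => m _.
rewrite !fct_scaleE -scalerAr; congr (_ *: _); rewrite /act /= /bact.
by case: ifP => _; rewrite ?mulr0 // mulrCA.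
Qed.

(** Take a nonzero entry of [x] and one of [y], and link them by a matrix unit [w]: the entry of
    [x w y] is their product with a nonzero scalar, hence nonzero in the domain [L]. *)
Theorem stat_eq_ideal_prime : prime_ideal (congr_ideal K stat_eq).
Proof.
have idR : two_sided_ideal (congr_ideal K stat_eq).
  apply: congr_ideal_two_sided => m s t [e1 e2]; split=> [|i];
    by rewrite ?contM ?bvM ?e1 ?e2.
have R0 x : congr_ideal K stat_eq x -> forall v, ract act x v = 0.
  by move=> hx v; apply: ract_congr hx => s t; apply: stat_eq_bact.
split=> // [R1|I1 I2 id1 id2 h12].
  have : congr_ideal K stat_eq 1 by rewrite R1.
  move=> /R0/(_ (ket [ffun=> 0%N]))/(congr1 (fun F => F [ffun=> 0%N])).
  rewrite (ract_gen act (mone : M)) /act /= bact1 /ket eqxx => /eqP.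
  by rewrite -[(0 : V) _]/(0 : L) oner_eq0.
apply: contrapT => /not_orP[/existsNP[x /not_implyP[x1 nx]] /existsNP[y /not_implyP[y2 ny]]].
have [p [q hx]] := ract_faithful nx; have [p' [q' hy]] := ract_faithful ny.
have [w [c [c0 hw]]] := exists_matrix_unit q p'.
have /R0/(_ (ket p))/(congr1 (fun F => F q')) : congr_ideal K stat_eq (x * w * y).
  by apply: h12 => //; case: id1 => _ _ /(_ w x x1)[].
rewrite !(ractM (act := act) bactM) hw ract_scaleL => /eqP.
by rewrite -[(0 : V) q']/(0 : L) !mulf_eq0 (negbTE c0) (negbTE hx) (negbTE hy).
Qed.
End BicyclicRepresentation.

(** * Elements acting as [p] and [q] at a single arc *)

Section ArcUnits.
Variable n : nat.
Implicit Types (a b : 'I_n * 'I_n) (l : 'I_n).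

(** Along a chain these elements give the raising and lowering operators of one tensor factor; the
    pair [qp], [pq] distinguishes [a] while all other arcs identify it. *)
Lemma arc_units a : (a.1 < a.2)%N -> exists p q : chinese_monoid n,
  [/\ bev a p = (1, 0)%N, bev a q = (0, 1)%N,
      forall b, (b.1 < b.2)%N -> nested a b || nested b a -> bev b p = 1%g /\ bev b q = 1%g &
      forall b, (b.1 < b.2)%N -> b != a -> bev b (q * p)%g = bev b (p * q)%g].
Proof.
case: a => x y /= xy; have [e|ne] := eqVneq x.+1 y.
  exists (cgen x), (cgen y); rewrite !bev_gen /arc_letter /= leqnn (leqNgt y) xy leqnn.
  split=> // -[i j] /=.
    rewrite /nested /= !bev_gen /arc_letter /= => ij h.
    by do 4?[case: leqP => ? //=]; exfalso; lia.
  move=> ij; rewrite xpair_eqE => nij.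
  have {}nij : ~~ ((i == x :> nat) && (j == y :> nat)) := nij.
  rewrite !bevM !bev_gen /arc_letter /=.
  by do 4?[case: leqP => ? //=]; exfalso; lia.
have x1n : (x.+1 < n)%N by have := ltn_ord y; lia.
have y1n : (y.-1 < n)%N by have := ltn_ord y; lia.
pose x1 := Ordinal x1n; pose y1 := Ordinal y1n.
(* An arc inside [(x, y)] sends [y.-1] and [x.+1] to [q] and [p], which cancel against [x] and [y];
   an arc around it sends all four letters to 1. *)
exists (cgen y1 * cgen x)%g, (cgen y * cgen x1)%g.
rewrite !bevM !bev_gen /arc_letter /=; split=> [||[i j]|[i j]] /=.
- by do 4?[case: leqP => ? //=]; exfalso; lia.
- by do 4?[case: leqP => ? //=]; exfalso; lia.
- rewrite /nested /= => ij h; rewrite !bevM !bev_gen /arc_letter /=.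
  by do 8?[case: leqP => ? //=]; exfalso; lia.
move=> ij; rewrite xpair_eqE => nij.
  have {}nij : ~~ ((i == x :> nat) && (j == y :> nat)) := nij.
rewrite !bevM !bev_gen /arc_letter /=.
by do 8?[case: leqP => ? //=]; exfalso; lia.
Qed.

End ArcUnits.

Section ChainPrimes.
Import mpoly.
Variables (K : fieldType) (n : nat).
Implicit Types (S : {set 'I_n * 'I_n}) (s t : chinese_monoid n).

Lemma arc_chainP S : arc_chain S -> {in S, forall a : 'I_n * 'I_n, (a.1 < a.2)%N} /\
  {in S &, forall a b : 'I_n * 'I_n, a != b -> nested a b || nested b a}.
Proof.
case/andP=> /forall_inP h1 /forall_inP h2; split=> // a b aS bS.
by have /forall_inP/(_ b bS) := h2 a aS; case: eqP.
Qed.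

(** For an arc [a] of [S'] outside [S], the pair [qp], [pq] of [arc_units] is congruent for [S] but
    not for [S']. *)
Lemma arc_congr_ideal_sub S S' : {in S, forall a : 'I_n * 'I_n, (a.1 < a.2)%N} ->
  {in S', forall a : 'I_n * 'I_n, (a.1 < a.2)%N} ->
  (congr_ideal K (arc_congr S) `<=` congr_ideal K (arc_congr S'))%classic ->
  S' \subset S.
Proof.
move=> hS hS' sub; apply/fintype.subsetP => a aS'; apply/negPn/negP => aS.
have [p [q [ap aq _ pq]]] := arc_units (hS' a aS').
have : arc_congr S (q * p)%g (p * q)%g.
  split=> [l|b bS]; first by rewrite !cntM addnC.
  by apply: pq; [apply: hS|apply: contraNneq aS => <-].
move=> /(congr_ideal_gen K)/sub/(congr_ideal_inv _ _)[] //.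
  move=> u v uv; split; apply: arc_congr_trans => //; exact: arc_congr_sym.
by move=> _ /(_ a aS'); rewrite !bevM ap aq !bicME.
Qed.

Lemma arc_chain_prime S : arc_chain S -> prime_ideal (congr_ideal K (arc_congr S)).
Proof.
case/arc_chainP=> arcS chainS; pose I : finType := {a | a \in S}.
have /choice[p hp] : forall i : I, exists p : chinese_monoid n, exists q,
  [/\ bev (val i) p = (1, 0)%N, bev (val i) q = (0, 1)%N &
      forall j : I, j != i -> bev (val j) p = 1%g /\ bev (val j) q = 1%g].
  move=> i; have [p [q [h1 h2 h3 _]]] := arc_units (arcS _ (valP i)).
  exists p, q; split=> // j ji; apply: h3; first exact: arcS (valP j).
  by apply: chainS (valP i) (valP j) _; rewrite eq_sym.
have /choice[q hq] := hp.
pose cont (m : chinese_monoid n) : 'X_{1..n} := [multinom cnt m l | l < n].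
pose bv (i : I) (m : chinese_monoid n) := bev (val i) m.
have cont_eq s t : cont s = cont t <-> cnt s =1 cnt t.
  split=> [/mnmP e l|e]; first by have := e l; rewrite !mnmE.
  by apply/mnmP => l; rewrite !mnmE e.
have -> : arc_congr S = stat_eq cont bv.
  apply/funext => s; apply/funext => t; apply/propext; split=> -[e1 e2].
    by split=> [|i]; [apply/cont_eq|apply: e2 (valP i)].
  by split=> [|a aS]; [apply/cont_eq|apply: (e2 (Sub a aS : I))].
apply: (@stat_eq_ideal_prime K _ I n cont bv _ _ _ p q) => [s t|i s t|i s t|i j|i j|i].
- by apply/mnmP => l; rewrite mnmDE !mnmE -cntM.
- exact: bevM.
- by move/cont_eq; apply: bev_cnt.
- have [h1 _ h3] := hq j; case: eqP => [->|/eqP ij]; first exact: h1.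
  exact: (h3 i ij).1.
- have [_ h2 h3] := hq j; case: eqP => [->|/eqP ij]; first exact: h2.
  exact: (h3 i ij).2.
- exact: bev1.
Qed.

End ChainPrimes.

(** * Leaves and maximal chains *)

Section TreeOfDiagrams.
Variable n : nat.
Implicit Types (b : seq (item n)) (c : item n) (d : diagram n).
Implicit Types (a t : 'I_n * 'I_n) (S : {set 'I_n * 'I_n}).

Definition arcs d : {set 'I_n * 'I_n} := [set a | inr a \in d].

Lemma mem_arcs b a : (a \in arcs (diag b)) = (inr a \in b).
Proof. by rewrite !inE. Qed.

Lemma branch_arc_lt b a : is_branch b -> inr a \in b -> (a.1 < a.2)%N.
Proof.
elim: b => [//|c b IH] br; rewrite inE => /orP[/eqP e|]; last exact: IH (branchW br).
case: a e {IH} => x y e; subst c; case: b br => [|c b] /=; first by move=> /eqP->.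
case/andP=> /lo_le_hi h /and3P[_ /eqP e1 /eqP e2].
by rewrite e2 ltnS (leq_trans _ h) // -e1 leqnSn.
Qed.

Lemma branch_arc_bound b a : is_branch b -> inr a \in b -> (lo b <= a.1)%N /\ (a.2 <= hi b)%N.
Proof.
case: a => x y br h.
have /andP[h1 _] := uses_bound br h (uses_lo (inr (x, y))).
by have /andP[_ h2] := uses_bound br h (uses_hi (inr (x, y))).
Qed.

Lemma branch_nested b a a' : is_branch b -> inr a \in b -> inr a' \in b -> a != a' ->
  nested a a' || nested a' a.
Proof.
elim: b => [//|c b IH] br ab a'b ne.
have inside a1 a2 : inr a1 = c -> inr a2 \in b -> nested a2 a1.
  case: a1 => x y e a2b; subst c; have [h1 h2] := branch_arc_bound (branchW br) a2b.
  case: b a2b br h1 h2 {IH ab a'b} => [//|c b] _ /andP[_ /and3P[_ /eqP e1 /eqP e2]] h1 h2.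
  by rewrite /nested /= e2 ltnS h2 andbT (leq_trans _ h1) // -e1.
move: ab a'b; rewrite !inE => /orP[/eqP e|ab] /orP[/eqP e'|a'b].
- by move: ne; case: (etrans e (esym e')) => ->; rewrite eqxx.
- by rewrite (inside a a') ?orbT.
- by rewrite (inside a' a).
- exact: IH (branchW br) ab a'b ne.
Qed.

Lemma branch_chain b : is_branch b -> arc_chain (arcs (diag b)).
Proof.
move=> br; apply/andP; split; apply/forall_inP => a; rewrite mem_arcs => ab.
  exact: branch_arc_lt br ab.
apply/forall_inP => a'; rewrite mem_arcs => ab'; case: eqP => //= /eqP ne.
by rewrite orbC; apply: branch_nested br ab' ab _; rewrite eq_sym.
Qed.

Lemma branch_cover b i : is_branch b -> b != [::] -> (lo b <= i <= hi b)%N ->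
  exists2 c, c \in b & uses c i.
Proof.
elim: b => [//|c b IH] br _ hi_; case: b => [|c' b] in br IH hi_ *.
  exists c; first exact: mem_head.
  case: c br hi_ => [s|[x y]] /=; rewrite /lo /hi /= ?maxn0.
    by have := ltn_ord s; move=> *; apply/eqP; lia.
  by have := ltn_ord x; have := ltn_ord y; move=> ? ? /eqP e; lia.
have [h|h] := boolP (lo (c' :: b) <= i <= hi (c' :: b))%N.
  have [c0 c0b u] := IH (branchW br) isT h.
  by exists c0; rewrite // inE c0b orbT.
exists c; first exact: mem_head.
move: hi_ h; rewrite (lo_consE c) (hi_consE c); case: c br => [s|[x y]] br.
  by have := child_dot br; have := lo_le_hi (branchW br); rewrite /=; lia.
case/andP: br => /lo_le_hi h0 /and3P[_ /eqP e1 /eqP e2]; rewrite /=; lia.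
Qed.

(** An arc comparable with all arcs of a branch lies outside its interval. While dots are being
    added on one side, only the inequality on the opposite side survives; the next arc restores
    both. *)
Lemma branch_max b c a : is_branch (c :: b) -> (a.1 < a.2)%N ->
  (forall a', inr a' \in c :: b -> nested a a' || nested a' a) ->
  match c with
  | inr _ => (a.1 < lo (c :: b))%N /\ (hi (c :: b) < a.2)%N
  | inl s => b != [::] ->
      (s = hi (c :: b) :> nat -> a.1 < lo (c :: b))%N /\
      (s = lo (c :: b) :> nat -> hi (c :: b) < a.2)%N
  end.
Proof.
elim: b c => [|c' b IH] c br ha cmp.
  case: c br cmp => [//|[x y]] br cmp; have [ex ey] := head_arc br.
  have := cmp _ (mem_head _ _); rewrite /nested /= -ex -ey; case/orP=> /andP[h1 h2] //.
  by move: br => /= /eqP; lia.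
have br' := branchW br; have l := lo_le_hi br'.
have {IH} := IH c' br' ha (fun a' h => cmp a' (mem_behead (s := c :: _) h)).
case: c br cmp => [s|[x y]] br cmp.
  have := child_dot br; case/andP: br => _.
  rewrite (lo_consE (inl s)) (hi_consE (inl s)) [item_lo _]/= [item_hi _]/=.
  case: c' {br' cmp} l => [u|[x y]] l; last by move=> _ ? [h1 h2] _; lia.
  case: b l => [//|c'' b] l /= /andP[_ h] hs /(_ isT) [h1 h2] _; move: h h1 h2.
  move: (lo _) (hi _) l hs => lo1 hi1 l hs; rewrite !andbA.
  case/orP=> /andP[/andP[/eqP h3 /eqP h4] _] h1 h2; split; lia.
have [ex ey] := head_arc br; move=> IH; rewrite -ex -ey.
have := cmp _ (mem_head _ _); rewrite /nested /=; case/orP=> /andP[h1 h2]; last first.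
  by split.
exfalso; case/andP: br => _ /and3P[_ /eqP e1 /eqP e2].
case: c' IH br' e1 e2 {cmp ex ey} l => [u|a'] IH br' e1 e2 l; last by lia.
case: b IH br' e1 e2 l => [|c'' b] IH br' e1 e2 l.
  by move: e1 e2; rewrite /lo /hi /= maxn0; have := ltn_ord u; lia.
by have [h3 h4] := IH isT; case: (head_dot br') => [/h4|/h3]; lia.
Qed.

(** Nothing can be added after an arc using an extreme index, so that arc is the last item of the
    branch. *)
Lemma leaf_branch d : leaf d -> exists x y b,
  [/\ is_branch (inr (x, y) :: b), diag (inr (x, y) :: b) = d &
      (x == 0 :> nat) || (y.+1 == n)].
Proof.
case=> -[b br <-] /existsP[x /existsP[y /andP[xyb e]]]; rewrite inE in xyb.
case: b br xyb => [//|c b] br; rewrite inE => /orP[/eqP cxy|xyb].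
  by exists x, y, b; rewrite cxy.
exfalso; have end_b : has_end_arc (diag b).
  by apply/existsP; exists x; apply/existsP; exists y; rewrite inE xyb.
case: b br xyb end_b => [//|c' b] /andP[_ ch] _ end_b; move: ch; case: c => [s|[i j]] /=.
  by case: c' end_b => [u|[i j]]; [case: b => // c'' b|] => ->.
by rewrite end_b.
Qed.

(** By [branch_max] the arcs of a leaf form a maximal chain, so the inclusion is an equality. The
    last arc spans the used interval, and the dots are the indices of this interval on no arc. *)
Lemma leaf_arcs_inj d d' : leaf d -> leaf d' -> arcs d \subset arcs d' -> d = d'.
Proof.
move=> /leaf_branch[x [y [b [br <- e]]]] /leaf_branch[x' [y' [b' [br' <- e']]]] sub.
have [ex ey] := head_arc br; have [ex' ey'] := head_arc br'.
set B := inr (x, y) :: b in br sub ex ey *; set B' := inr _ :: b' in br' sub ex' ey' *.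
have sub1 a : inr a \in B -> inr a \in B'.
  by rewrite -!mem_arcs; move/fintype.subsetP: sub; apply.
have sub2 a : inr a \in B' -> inr a \in B.
  move=> aB'; apply/negPn/negP => aB.
  have [] := @branch_max b (inr (x, y)) a br (branch_arc_lt br' aB').
    move=> a' /[dup] a'B /sub1 a'B'; apply: branch_nested br' aB' a'B' _.
    by apply: contraNneq aB => ->.
  by rewrite -/B -ex -ey; have := ltn_ord a.2; case/orP: e => /eqP; lia.
have [lo_eq hi_eq] : lo B = lo B' /\ hi B = hi B'.
  have [h1 h2] := branch_arc_bound br' (sub1 _ (mem_head _ _)).
  have [h3 h4] := branch_arc_bound br (sub2 _ (mem_head _ _)).
  by move: h1 h2 h3 h4 => /=; lia.
have dots (B1 B2 : seq (item n)) s : is_branch B1 -> is_branch B2 -> B2 != [::] ->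
    lo B1 = lo B2 -> hi B1 = hi B2 -> (forall a, inr a \in B2 -> inr a \in B1) ->
    inl s \in B1 -> inl s \in B2.
  move=> br1 br2 n2 l h sub21 s1.
  have := uses_bound br1 s1 (uses_lo _); rewrite l h => /(branch_cover br2 n2)[[s'|a]] c2 u.
    by move: u => /= /eqP/val_inj<-.
  have := uses_inj br1 s1 (sub21 _ c2) (uses_lo _) u; by [].
apply/setP => -[s|a]; rewrite !inE; last by apply/idP/idP; [apply: sub1|apply: sub2].
by apply/idP/idP; [apply: (dots B B')|apply: (dots B' B)].
Qed.


Lemma lo_gt0_no_end b : is_branch b -> (0 < lo b)%N -> ((hi b).+1 < n)%N ->
  has_end_arc (diag b) = false.
Proof.
move=> br h1 h2; apply/negbTE/negP => /existsP[x /existsP[y /andP[]]].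
by rewrite inE => /(branch_arc_bound br)[] /=; move=> ? ? /orP[]/eqP; lia.
Qed.

Lemma child_arc b c t : is_branch (c :: b) ->
  (t.1.+1 = lo (c :: b) -> t.2 = (hi (c :: b)).+1 :> nat ->
   is_branch [:: inr t, c & b])%N.
Proof.
case: t => x y /= br e1 e2; rewrite /= in br *; rewrite br /= e1 e2 !eqxx !andbT.
by rewrite (@lo_gt0_no_end (c :: b)) // -?e1 // -e2; apply: ltn_ord.
Qed.

Lemma child_dot_right b c (s : 'I_n) : is_branch (c :: b) ->
  (if c is inl t then b != [::] /\ t = hi (c :: b) :> nat else True) ->
  (0 < lo (c :: b))%N -> s = (hi (c :: b)).+1 :> nat -> (s.+1 < n)%N ->
  is_branch [:: inl s, c & b].
Proof.
move=> br hc l0 es sn; have ne := @lo_gt0_no_end _ br l0; rewrite -es ltn_ord in ne.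
rewrite /= in br *; rewrite br /=; case: c br hc l0 es ne => [t|[x y]] br hc l0 es ne.
  case: b br hc l0 es ne => [|c' b] br [hb ht] l0 es ne //.
  by rewrite ne //= sn ht es !eqxx.
by rewrite ne //= sn es !eqxx.
Qed.

Lemma child_dot_left b c (s : 'I_n) : is_branch (c :: b) ->
  (if c is inl t then b != [::] /\ t = lo (c :: b) :> nat else True) ->
  ((hi (c :: b)).+1 < n)%N -> s.+1 = lo (c :: b) :> nat -> (0 < s)%N ->
  is_branch [:: inl s, c & b].
Proof.
move=> br hc hn es s0; have ne := @lo_gt0_no_end _ br; rewrite -es /= in ne.
have {}ne := ne isT hn.
rewrite /= in br *; rewrite br /=; case: c br hc hn es ne => [t|[x y]] br hc hn es ne.
  case: b br hc hn es ne => [|c' b] br [hb ht] hn es ne //.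
  by rewrite ne //= s0 ht es !eqxx orbT.
by rewrite ne //= s0 es !eqxx orbT.
Qed.

(** The gap of length [k] on the right is filled with dots before [t] is added; the tree allows this
    only if a dot added last is not on the left. *)
Lemma reach_right k b c t : is_branch (c :: b) ->
  (if c is inl u then b != [::] /\ u = hi (c :: b) :> nat else True) ->
  t.1.+1 = lo (c :: b) -> t.2 = ((hi (c :: b)).+1 + k)%N :> nat ->
  exists b', is_branch (inr t :: b') /\ {subset c :: b <= b'}.
Proof.
elim: k b c => [|k IH] b c br hc e1 e2.
  by exists (c :: b); split=> //; apply: child_arc; rewrite // e2 addn0.
have sn : ((hi (c :: b)).+1 < n)%N by have := ltn_ord t.2; lia.
pose s := Ordinal sn; have br' : is_branch [:: inl s, c & b].
  by apply: child_dot_right; rewrite //= -?e1 //; have := ltn_ord t.2; lia.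
have lh := lo_le_hi br.
have [|||b' [br'' sub]] := IH (c :: b) (inl s) br'.
- by split=> //; rewrite (hi_consE (inl s)) /=; lia.
- by rewrite (lo_consE (inl s)) /=; lia.
- by rewrite (hi_consE (inl s)) /=; lia.
by exists b'; split=> // z zb; apply: sub; rewrite inE zb orbT.
Qed.

Lemma reach_left k b c t : is_branch (c :: b) ->
  (if c is inl u then b != [::] /\ u = lo (c :: b) :> nat else True) ->
  (t.1 + k).+1 = lo (c :: b) -> t.2 = (hi (c :: b)).+1 :> nat ->
  exists b', is_branch (inr t :: b') /\ {subset c :: b <= b'}.
Proof.
elim: k b c => [|k IH] b c br hc e1 e2.
  by exists (c :: b); split=> //; apply: child_arc; rewrite // -e1 addn0.
have lh := lo_le_hi br.
have sn : ((lo (c :: b)).-1 < n)%N by have := ltn_ord t.2; lia.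
pose s := Ordinal sn; have br' : is_branch [:: inl s, c & b].
  by apply: child_dot_left; rewrite //= -?e2 -?e1 //=; have := ltn_ord t.2; lia.
have [|||b' [br'' sub]] := IH (c :: b) (inl s) br'.
- by split=> //; rewrite (lo_consE (inl s)) /=; lia.
- by rewrite (lo_consE (inl s)) /=; lia.
- by rewrite (hi_consE (inl s)) /=; lia.
by exists b'; split=> // z zb; apply: sub; rewrite inE zb orbT.
Qed.

(** Adjacent arcs are added around [a] until one end is next to that of [t]; dots fill the remaining
    gap on the other side. *)
Lemma reach_arc b a t : is_branch (inr a :: b) -> nested a t ->
  exists b', is_branch (inr t :: b') /\ {subset inr a :: b <= b'}.
Proof.
move: {2}(a.1 : nat) (leqnn a.1) => k; elim: k a b => [|k IH] a b hk br /andP[h1 h2].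
  by move: h1; lia.
have [ex ey] : a.1 = lo (inr a :: b) :> nat /\ a.2 = hi (inr a :: b) :> nat.
  by case: a br {hk h1 h2} => x y /head_arc.
have [e1|n1] := eqVneq t.1.+1 (a.1 : nat).
  apply: (@reach_right (t.2 - a.2.+1) b (inr a)) => //; first by rewrite e1 ex.
  by rewrite -ey; lia.
have [e2|n2] := eqVneq a.2.+1 (t.2 : nat).
  apply: (@reach_left (a.1.-1 - t.1) b (inr a)) => //; last by rewrite -ey.
  by rewrite -ex; lia.
have xn : (a.1.-1 < n)%N by have := ltn_ord a.1; lia.
have yn : (a.2.+1 < n)%N by have := ltn_ord t.2; lia.
pose a' := (Ordinal xn, Ordinal yn).
have br' : is_branch [:: inr a', inr a & b] by apply: child_arc; rewrite //= -?ex -?ey; lia.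
have [||b' [br'' sub]] := IH a' (inr a :: b) _ br'.
- by rewrite /=; lia.
- by rewrite /nested /=; lia.
by exists b'; split=> // z zb; apply: sub; rewrite inE zb orbT.
Qed.

Lemma first_arc t : (t.1 < t.2)%N -> exists b, is_branch (inr t :: b).
Proof.
move=> ht; have [e|n1] := eqVneq t.1.+1 (t.2 : nat).
  by exists [::]; case: t ht e => x y /= _ ->.
have x1 : (t.1.+1 < n)%N by have := ltn_ord t.2; lia.
pose s := Ordinal x1; have [e|n2] := eqVneq t.1.+2 (t.2 : nat).
  by exists [:: inl s]; apply: child_arc; rewrite /lo /hi /=; have := ltn_ord t.2; lia.
(* With at least two indices strictly inside [t], the branch starts from the adjacent arc
   [(t.1.+1, t.1.+2)]. *)
have x2 : (t.1.+2 < n)%N by have := ltn_ord t.2; lia.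
have br : is_branch [:: inr (s, Ordinal x2)] by rewrite /=.
have [|b' [br' _]] := reach_arc (t := t) br; last by exists b'.
by rewrite /nested /=; lia.
Qed.

Lemma branch_to_leaf b a : is_branch (inr a :: b) ->
  exists b', [/\ is_branch b', has_end_arc (diag b') & {subset inr a :: b <= b'}].
Proof.
move=> br; have ha := branch_arc_lt br (mem_head _ _).
have end_arc b' (t : 'I_n * 'I_n) : inr t \in b' -> (t.1 == 0 :> nat) || (t.2.+1 == n) ->
    has_end_arc (diag b').
  case: t => x y tb e; apply/existsP; exists x; apply/existsP; exists y.
  by rewrite inE tb.
have [e|] := boolP ((a.1 == 0 :> nat) || (a.2.+1 == n)).
  by exists (inr a :: b); split=> //; apply: end_arc e; apply: mem_head.
rewrite negb_or => /andP[a1 a2].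
(* Widening [a] by [m] on both sides reaches index 0 or [n.-1] first on the nearer side. *)
pose m := minn a.1 (n.-1 - a.2).
have xn : (a.1 - m < n)%N by have := ltn_ord a.1; lia.
have yn : (a.2 + m < n)%N by have := ltn_ord a.2; lia.
pose t := (Ordinal xn, Ordinal yn).
have nat_ : nested a t by rewrite /nested /=; have := ltn_ord a.2; lia.
have [b' [br' sub]] := reach_arc br nat_; exists (inr t :: b'); split=> //.
  by apply: (end_arc _ t); [apply: mem_head|rewrite /=; have := ltn_ord a.2; lia].
by move=> z /sub zb; rewrite inE zb orbT.
Qed.

(** Induction removes the outermost arc, the one with the least left end, and reattaches it by
    [reach_arc]. *)
Lemma chain_in_branch S : arc_chain S -> S != finset.set0 ->
  exists a b, [/\ is_branch (inr a :: b), a \in S &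
    forall a', a' \in S -> inr a' \in inr a :: b].
Proof.
move: {2}#|S| (leqnn #|S|) => k; elim: k S => [|k IH] S hk cS S0.
  by move: hk; rewrite leqn0 cards_eq0 (negbTE S0).
case/finset.set0Pn: S0 => a0 a0S.
case: (@arg_minnP _ a0 (fun a => a \in S) (fun a => a.1 : nat) a0S) => a aS amin.
have /andP[/forall_inP arcS /forall_inP nestS] := cS.
have [S1|S1] := eqVneq (S :\ a) finset.set0.
  have [b br] := first_arc (arcS a aS); exists a, b; split=> // a' a'S.
  have [->|ne] := eqVneq a' a; first exact: mem_head.
  by have := finset.in_set0 a'; rewrite -S1 !inE ne a'S.
have [||a1 [b [br a1S sub]]] := IH (S :\ a) _ _ S1.
- by move: hk; rewrite (cardsD1 a S) aS; lia.
- apply/andP; split; apply/forall_inP => a1; rewrite !inE => /andP[_ a1S]; first exact: arcS.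
  apply/forall_inP => a2; rewrite !inE => /andP[_ a2S].
  by have /forall_inP/(_ a2 a2S) := nestS a1 a1S.
move: a1S; rewrite !inE => /andP[ne a1S].
have na : nested a1 a.
  have /forall_inP/(_ a aS) := nestS a1 a1S; rewrite (negbTE ne) /=.
  by case/orP=> // /andP[h _]; have := amin a1 a1S; lia.
have [b' [br' sub']] := reach_arc br na; exists a, b'; split=> // a' a'S.
have [->|ne'] := eqVneq a' a; first exact: mem_head.
by rewrite inE; apply/orP; right; apply/sub'/sub; rewrite !inE ne'.
Qed.

Lemma chain_in_leaf S : (1 < n)%N -> arc_chain S -> exists2 d, leaf d & S \subset arcs d.
Proof.
move=> n1 cS; have [a [b [br sub]]] : exists a b, is_branch (inr a :: b) /\
    forall a', a' \in S -> inr a' \in inr a :: b.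
  have [->|S0] := eqVneq S finset.set0; last first.
    by have [a [b [h1 _ h3]]] := chain_in_branch cS S0; exists a, b.
  pose t := (Ordinal (ltnW n1), Ordinal n1).
  have [b br] : exists b, is_branch (inr t :: b) by apply: first_arc.
  by exists t, b; split=> // a'; rewrite finset.in_set0.
have [b' [br' e sub']] := branch_to_leaf br.
exists (diag b'); first by split=> //; exists b'.
by apply/fintype.subsetP => a' /sub/sub'; rewrite mem_arcs.
Qed.

End TreeOfDiagrams.

(** * The congruence of a leaf *)

Section BicyclicIsomorphism.

Definition to_bic (u : bicyclic) : bic :=
  extend (fun x : bool => (if x then (0, 1)%N else (1, 0)%N) : bic) u.

Definition of_bic (u : bic) : bicyclic := (bp ^+ u.1 * bq ^+ u.2)%g.

Lemma to_bic_morph : [/\ to_bic bp = (1, 0)%N, to_bic bq = (0, 1)%N,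
  to_bic 1%g = 1%g & {morph to_bic : x y / (x * y)%g >-> (x * y)%g}].
Proof.
have [h1 h2 h3] : [/\ (forall x, to_bic (pgen _ x) = if x then (0, 1)%N else (1, 0)%N),
    to_bic 1%g = 1%g & {morph to_bic : x y / (x * y)%g >-> (x * y)%g}].
  by apply: extend_morphism => u v [] //; rewrite !big_cons !big_nil.
by split=> //; rewrite /bp /bq h1.
Qed.

Lemma of_bicK : cancel of_bic to_bic.
Proof.
have [h1 h2 h3 h4] := to_bic_morph.
have hp k : to_bic (bp ^+ k)%g = (k, 0)%N.
  by elim: k => [|k IH]; rewrite ?h3 // expgS h4 IH h1 bicME /=; congr pair; lia.
have hq k : to_bic (bq ^+ k)%g = (0, k)%N.
  by elim: k => [|k IH]; rewrite ?h3 // expgS h4 IH h2 bicME /=; congr pair; lia.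
by move=> [c d]; rewrite /of_bic h4 hp hq bicME /=; congr pair; lia.
Qed.

Lemma of_bicM : {morph of_bic : x y / (x * y)%g >-> (x * y)%g}.
Proof.
have qp k l : (bq ^+ k * bp ^+ l = bp ^+ (l - k) * bq ^+ (k - l))%g.
  elim: k l => [|k IH] [|l]; rewrite ?expg0 ?mul1g ?mulg1 ?subn0 ?expg0 ?mul1g ?mulg1 //.
  rewrite expgSr expgS -mulgA (mulgA bq) bqp mul1g IH //.
move=> [c d] [c' d']; rewrite /of_bic bicME /= [(d' + _)%N]addnC !expgnDr -!mulgA.
congr (_ * _)%g.
by rewrite !mulgA qp.
Qed.

Lemma of_bic_prod (I : Type) (r : seq I) (F : I -> bic) :
  (\prod_(i <- r) of_bic (F i) = of_bic (\prod_(i <- r) F i))%g.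
Proof.
elim: r => [|i r IH]; last by rewrite !big_cons IH of_bicM.
by rewrite !big_nil /of_bic /= !expg0 mulg1.
Qed.

End BicyclicIsomorphism.

(** * The kernel of [kappa] in terms of contents and arcs *)

Section LeafCongruence.
Variable n : nat.
Implicit Types (b : seq (item n)) (c : item n) (d : diagram n) (l : 'I_n) (w : seq 'I_n).
Implicit Types (a : 'I_n * 'I_n).

Definition Cel b l : Cmon b :=
  match b return Cmon b with [::] => pgen _ (l : Cgen [::]) | c :: b' => Celt b' c l end.

Definition unused b l : bool := (b == [::]) || (l < lo b)%N || (hi b < l)%N.

(** A letter already used at an earlier step has become 1 in [C_t], so later steps record nothing
    for it. *)
Fixpoint Sel b l : Smon b :=
  match b return Smon b with
  | [::] => tt
  | c :: b' => ((if unused b' l then step_elt c l else 1%g), Sel b' l)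
  end.

Lemma psi_Cel b c l : is_branch (c :: b) ->
  psi c (Cel b l) = (Cel (c :: b) l, if unused b l then step_elt c l else 1%g).
Proof.
move=> br; have [h1 h2 _] := psi_morphism br.
case: b br h1 h2 => [|c' b] br h1 h2; first exact: h1.
rewrite -[Cel (c' :: b) l]/(Celt b c' l) -[Cel [:: c, c' & b] l]/(Celt (c' :: b) c l).
rewrite {1}/Celt; case: insubP => [i hi_ ei|hi_].
  by rewrite [LHS](h1 i) /= ei /unused /= hi_.
rewrite h2 /unused /= (negbTE hi_) -[RHS]/(Celt (c' :: b) c l, _) Celt_used //.
move: hi_; rewrite negb_or -!leqNgt => /andP[h3 h4].
by rewrite (leq_trans (lo_cons _ _) h3) (leq_trans h4 (hi_cons _ _)).
Qed.

Lemma kappa_morph b : is_branch b -> kappa b 1%g = (1%g, 1%g) /\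
  forall s t, kappa b (s * t)%g = (kappa b s * kappa b t)%g.
Proof.
elim: b => [|c b IH] br; first by split=> // s t; rewrite /=; congr pair.
have [h1 h2] := IH (branchW br); have [_ p1 pM] := psi_morphism br.
split=> [|s t] /=; first by rewrite h1 p1.
rewrite h2; case: (kappa b s) => m1 s1; case: (kappa b t) => m2 s2 /=.
by rewrite pM; case: (psi c m1) => ? ?; case: (psi c m2) => ? ?.
Qed.

Lemma kappa_cgen b l : is_branch b -> kappa b (cgen l) = (Cel b l, Sel b l).
Proof.
elim: b => [|c b IH] br; first by rewrite /= /cgen cwordE.
by rewrite /= (IH (branchW br)) psi_Cel.
Qed.

Lemma kappa_cword b w : is_branch b ->
  kappa b (cword w) = (\prod_(l <- w) Cel b l, \prod_(l <- w) Sel b l)%g.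
Proof.
move=> br; have [h1 hM] := kappa_morph br.
elim: w => [|l w IH]; first by rewrite cword0 h1 !big_nil.
by rewrite cword_cons hM IH kappa_cgen // !big_cons.
Qed.

Definition item_stat c w1 w2 : Prop :=
  match c with
  | inl s => count_mem s w1 = count_mem s w2
  | inr a => bev a (cword w1) = bev a (cword w2) /\ count_mem a.1 w1 = count_mem a.1 w2
  end.

Lemma natM_count (F : 'I_n -> natM) l w :
  F =1 (fun k => if k == l then natM_g else 1%g) -> (\prod_(k <- w) F k)%g = count_mem l w.
Proof.
move=> hF; elim: w => [|k w IH]; first by rewrite big_nil.
by rewrite big_cons IH hF /=; case: eqP.
Qed.

Lemma intM_count (F : 'I_n -> intM) l w :
  F =1 (fun k => if k == l then intM_g else 1%g) ->
  (\prod_(k <- w) F k)%g = Posz (count_mem l w).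
Proof.
move=> hF; elim: w => [|k w IH]; first by rewrite big_nil.
rewrite big_cons IH hF /=; case: eqP => _ /=; first by [].
by rewrite mul1g.
Qed.

(** For an arc, the letters strictly between its ends are exactly those already used, so the
    recorded bicyclic component is [bev]; the integer component counts the left end. *)
Lemma step_stat b c w1 w2 : is_branch (c :: b) ->
  (\prod_(l <- w1) (if unused b l then step_elt c l else 1) =
   \prod_(l <- w2) (if unused b l then step_elt c l else 1))%g <-> item_stat c w1 w2.
Proof.
case: c => [s|[x y]] br.
  have us : unused b s.
    rewrite /unused; case: b br => [//|c' b] br; rewrite orFb.
    by have := child_dot br; lia.
  have E k : (if unused b k then step_elt (inl s) k else 1%g) =
      (if k == s then natM_g else 1%g : natM).
    by rewrite /=; case: eqP => [->|_]; rewrite ?us //; case: ifP.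
  by rewrite !(natM_count _ E).
have E k : (if unused b k then step_elt (inr (x, y)) k else 1%g) =
    (of_bic (arc_letter (x, y) k), if k == x then intM_g else 1%g) :> (bicyclic * intM)%type.
  have p1 : of_bic (1, 0)%N = bp by rewrite /of_bic expg1 expg0 mulg1.
  have q1 : of_bic (0, 1)%N = bq by rewrite /of_bic expg1 expg0 mul1g.
  have z1 : of_bic (0, 0)%N = 1%g by rewrite /of_bic !expg0 mulg1.
  rewrite /arc_letter /=; case: b br => [|c' b] br.
    have /eqP xy : y == x.+1 :> nat by case/andP: br.
    by rewrite /unused /=; case: leqP => h; rewrite ?p1 // xy h q1.
  case/andP: br => /lo_le_hi l /and3P[_ /eqP e1 /eqP e2].
  rewrite /unused orFb; case: (leqP k x) => kx.
    by rewrite p1 ifT //; apply/orP; left; lia.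
  case: (leqP y k) => ky.
    by rewrite q1 ifT //; apply/orP; right; lia.
  rewrite z1 ifF; last by apply/negbTE; rewrite negb_or -!leqNgt; lia.
  by rewrite ifF //; apply/eqP => kx'; rewrite kx' ltnn in kx.
have P w : (\prod_(l <- w) (if unused b l then step_elt (inr (x, y)) l else 1))%g =
    (of_bic (bev (x, y) (cword w)), Posz (count_mem x w)) :> (bicyclic * intM)%type.
  rewrite bev_cword -of_bic_prod -(@intM_count (fun k => if k == x then intM_g else 1%g) x) //.
  by elim: w => [|k w IH]; rewrite ?big_nil // !big_cons IH E.
rewrite !P; split=> [[/(can_inj of_bicK) h1 h2]|[-> /= ->]] //.
Qed.

Lemma Sel_stat b w1 w2 : is_branch b ->
  (\prod_(l <- w1) Sel b l = \prod_(l <- w2) Sel b l)%g <->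
  (forall c, c \in b -> item_stat c w1 w2).
Proof.
elim: b => [|c b IH] br.
  by split=> // _; case: (\prod_(l <- w1) _)%g; case: (\prod_(l <- w2) _)%g.
have P w : (\prod_(l <- w) Sel (c :: b) l =
    (\prod_(l <- w) (if unused b l then step_elt c l else 1), \prod_(l <- w) Sel b l))%g.
  by elim: w => [|k w IHw]; rewrite ?big_nil // !big_cons IHw.
rewrite !P; split=> [[/(step_stat _ _ br) h1 /(IH (branchW br)) h2] c'|h].
  by rewrite inE => /orP[/eqP->|/h2].
congr pair; first by apply/(step_stat _ _ br)/h/mem_head.
by apply/(IH (branchW br)) => c' h'; apply: h; rewrite inE h' orbT.
Qed.

(** All relations of [C_t] preserve the number of occurrences of each generator. *)
Lemma Cel_count b c w1 w2 l : is_branch (c :: b) -> unused (c :: b) l ->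
  (\prod_(k <- w1) Cel (c :: b) k = \prod_(k <- w2) Cel (c :: b) k)%g ->
  count_mem l w1 = count_mem l w2.
Proof.
move=> br ul; pose f (i : Cgen (c :: b)) : natM := if Cidx i == l then natM_g else 1%g.
have natC (u v : natM) : (u * v = v * u)%g by exact: addnC.
have [h1 h2 h3] : [/\ (forall x, extend f (pgen _ x : Cmon (c :: b)) = f x),
    extend f (1 : Cmon (c :: b))%g = 1%g
    & {morph (extend f : Cmon (c :: b) -> natM) : x y / (x * y)%g >-> (x * y)%g}].
  apply: extend_morphism => u v [i k j _|i k j _|i j _]; rewrite !big_cons !big_nil !mulg1.
  - by rewrite (natC (f i)).
  - by rewrite !mulgA (natC (f j)).
  - exact: natC.
have E w : extend f (\prod_(k <- w) Cel (c :: b) k)%g = count_mem l w.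
  elim: w => [|k w IH]; first by rewrite big_nil h2.
  rewrite big_cons h3 IH /= /Celt; case: insubP => [i _ ei|nk].
    by rewrite h1 /f /= ei; case: eqP.
  rewrite h2; case: eqP => [kl|_]; last by rewrite mul1g.
  by move: nk; rewrite kl; move: ul; rewrite /unused orFb => ->.
by move=> /(congr1 (extend f)); rewrite !E.
Qed.

(** The point is that [kappa] determines the full content at a leaf, although it does not count
    right ends of arcs directly; these are recovered from [bev_balance]. *)
Lemma leaf_rho d : leaf d -> @rho n d = arc_congr (arcs d).
Proof.
case/leaf_branch=> x [y [b0 [br <- end_xy]]]; set b := inr (x, y) :: b0.
have [ex ey] := head_arc br; rewrite -/b in br ex ey.
apply/funext => s; apply/funext => t; apply/propext.
rewrite -(cword_repr s) -(cword_repr t); move: (repr s) (repr t) => w1 w2.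
split=> [[b' [br' eb' ek]]|[e1 e2]].
  rewrite {b' br' eb'}(branch_unique br' br eb') in ek.
  move: ek; rewrite !kappa_cword // => -[eC /(Sel_stat _ _ br) eS].
  have known l : (forall a, inr a \in b -> a.2 != l) -> cnt (cword w1) l = cnt (cword w2) l.
    move=> nl; rewrite !cnt_cword; have [ul|nul] := boolP (unused b l).
      exact: Cel_count br ul eC.
    move: nul; rewrite /unused orFb negb_or -!leqNgt => /(branch_cover br isT)[c cb].
    move: (eS c cb); case: c cb => [k|[i j]] cb /= st.
      by move/eqP => kl; move: st; rewrite (val_inj kl).
    have := nl _ cb => /= jl /orP[/eqP il|/eqP/val_inj jl']; last by rewrite jl' eqxx in jl.
    by move: st.2; rewrite (val_inj il).
  (* In a nested family no right end is at most a left end. *)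
  have le_known a l : inr a \in b -> (l <= a.1)%N -> cnt (cword w1) l = cnt (cword w2) l.
    move=> ab la; apply: known => a' ab'; apply/eqP => e.
    have := branch_arc_lt br ab; have := branch_arc_lt br ab'; move: la; rewrite -e.
    have [->|ne] := eqVneq a a'; first by lia.
    by have := branch_nested br ab ab' ne; rewrite /nested; lia.
  split; last by move=> a; rewrite mem_arcs => /eS[].
  (* Descending induction on [l]: for a right end [l] of an arc [a], the letters up to [a.1] and
     those above [l] are known, so the balance at [a] gives the count of [l]. *)
  move=> l; move: {2}(n - l)%N (leqnn (n - l)) => k; elim: k l => [|k IH] l hk.
    by have := ltn_ord l; lia.
  have [nl|] := pselect (forall a, inr a \in b -> a.2 != l); first exact: known.
  case/existsNP=> a /not_implyP[ab /negP]; rewrite negbK => /eqP al.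
  have [be _] := eS _ ab; have := bev_balance a (cword w1); have := bev_balance a (cword w2).
  have -> : pcount a (cword w1) = pcount a (cword w2).
    by apply: eq_bigr => i _; case: leqP => // ia; rewrite (le_known a).
  rewrite be /qcount (bigD1 l) //= [in X in _ -> X](bigD1 l) //= -al leqnn.
  rewrite (branch_arc_lt br ab) /= !mul1n.
  set r1 := (\sum_(i < n | i != a.2) _)%N; set r2 := (\sum_(i < n | i != a.2) _)%N.
  suff -> : r1 = r2 by lia.
  apply: eq_bigr => i ine; case: (leqP a.2 i) => ai; rewrite ?andbF //.
  have {}ai : (l < i)%N.
    by rewrite ltn_neqAle -al ai andbT; apply: contraNneq ine => /val_inj->.
  by rewrite IH //; lia.
(* At a leaf one side of the interval is empty, so the images in [C_t] commute and depend only on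
   the content. *)
exists b; split=> //; rewrite !kappa_cword //; congr pair.
  apply: perm_prodg => [k l _ _|].
    apply: Celt_com; rewrite -/b -ex -ey; have := ltn_ord k; have := ltn_ord l.
    by case/orP: end_xy => /eqP; lia.
  by apply/allP => l _; rewrite /= -!cnt_cword e1.
apply/(Sel_stat _ _ br) => -[k|a] cb /=; rewrite -!cnt_cword //.
by split=> //; apply: e2; rewrite mem_arcs.
Qed.

End LeafCongruence.

(** * Leaf ideals and minimal primes *)

Section LeafIdeals.
Variables (K : fieldType) (n : nat).
Implicit Types (d : diagram n) (P : set {malg K[chinese_monoid n]}).

Lemma leaf_prime d : leaf d -> prime_ideal (congr_ideal K (@rho n d)).
Proof.
move=> ld; rewrite leaf_rho //; apply: arc_chain_prime.
by have [[b br <-] _] := ld; apply: branch_chain.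
Qed.

Lemma leaf_ideal_inj d d' : leaf d -> leaf d' ->
  (congr_ideal K (@rho n d') `<=` congr_ideal K (@rho n d))%classic -> d = d'.
Proof.
move=> ld ld'; rewrite !leaf_rho // => sub; apply: leaf_arcs_inj => //.
have arcs_lt e : leaf e -> {in arcs e, forall a : 'I_n * 'I_n, (a.1 < a.2)%N}.
  by case=> -[b br <-] _ a; rewrite mem_arcs; apply: branch_arc_lt.
exact: arc_congr_ideal_sub (arcs_lt _ ld') (arcs_lt _ ld) sub.
Qed.

Lemma prime_contains_leaf P : (1 < n)%N -> prime_ideal P ->
  exists2 d, leaf d & (congr_ideal K (@rho n d) `<=` P)%classic.
Proof.
move=> n1 primeP; have [idP _ _] := primeP.
have [S chS mS] := @prime_merges_chain n {malg K[chinese_monoid n]}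
  (fun m => << m >>%R) P (fun s t => esym (malg_genM K s t)) erefl
  (fun u v => @malg_span K _ P u v idP) primeP.
have [d ld sub] := chain_in_leaf n1 chS; exists d => //; rewrite leaf_rho //.
by apply: congr_ideal_sub => // s t st; apply: mS; apply: arc_congrS st.
Qed.

End LeafIdeals.

Local Open Scope classical_set_scope.

Theorem theorem2p3p2 (K : fieldType) (n : nat) (hn : (3 <= n)%N) :
  set_bij [set d : diagram n | leaf d]
          [set P : set {malg K[chinese_monoid n]} | minimal_prime P]
          (fun d => congr_ideal K (@rho n d)).
Proof.
have n1 : (1 < n)%N := ltnW hn.
split=> [d /= ld|d d' /set_mem ld /set_mem ld' /= e|P /= [primeP minP]].
(* A prime [Q] below a leaf ideal contains some leaf ideal in turn; incomparability makes the two
   leaves equal. *)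
- split=> [|Q primeQ sub]; first exact: leaf_prime.
  have [d' ld' sub'] := prime_contains_leaf n1 primeQ.
  apply/seteqP; split=> //.
  by rewrite (leaf_ideal_inj ld ld' (subset_trans sub' sub)).
- by apply: (leaf_ideal_inj (K := K)) ld ld' _; rewrite e.
- have [d ld sub] := prime_contains_leaf n1 primeP; exists d => //.
  exact: minP (leaf_prime K ld) sub.
Qed.
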